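(* Fix $\gamma\in(0,1)$ and let $d_N=(1-\gamma)\sqrt{\frac{\log N}{2\log\log N}}$ and $M=\exp\{2\sqrt{\log N\log\log N}\}$. Let $\varepsilon>0$ be sufficiently small. Let $d,N\in\mathbb{N}$ with $2\leqslant d\leqslant d_N$, and let $G$ be a group of order $N$ such that (a) $G$ contains at most $N^{(2+\varepsilon)/4}$ involutions; (b) $G$ contains at most $N^{1/d}$ elements $x$ with $\operatorname{cl}(x)\leqslant M$; (c) $G$ contains at most $N^{1/(2d)}$ involutions $x$ with $\operatorname{cl}(x)\leqslant M$. If $\Gamma\in\mathcal{G}(G,p)$ with $p\geqslant\sqrt[d]{\frac{1+\varepsilon}{2^d}\cdot\frac{\log N}{N^{d-1}}}$, then with high probability the diameter of $\Gamma$ is at most $d$; that is, $\Pr(\operatorname{diam}(\Gamma)>d)\to0$ as $N\to\infty$, uniformly over all groups $G$ satisfying (a)–(c), all such $d$ and all such $p$.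
   Context: For a group $G$ and a subset $S\subseteq G$, the (undirected) Cayley graph $\Gamma(G;S)$ has vertex set $G$ and an edge between $g\neq h$ iff $g^{-1}h\in S$ or $h^{-1}g\in S$ (loops and multiple edges ignored). The model $\mathcal{G}(G,p)$ is the probability space of Cayley graphs $\Gamma(G;S)$ where each element of $G$ is put in $S$ independently with probability $p$. The diameter of a disconnected graph is infinite. For $x\in G$, $\operatorname{cl}(x)$ is the size of the conjugacy class $\{y^{-1}xy:y\in G\}$. An involution is an element $x$ with $x^2=1$. *)

(* Defs.v *)
From HB Require Import structures.
From mathcomp Require Import all_boot all_order all_algebra all_fingroup.
From mathcomp Require Import boolp reals.
From mathcomp.analysis Require Import sequences exp.
Set Implicit Arguments. Unset Strict Implicit. Unset Printing Implicit Defensive.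
Import Order.TTheory GRing.Theory Num.Theory.
Local Open Scope ring_scope.

Definition cay_adj (gT : finGroupType) (S : {set gT}) : rel gT :=
  fun g h => (g != h) && (((g^-1 * h)%g \in S) || ((h^-1 * g)%g \in S)).

Definition dist_le (gT : finGroupType) (S : {set gT}) (d : nat) (g h : gT) : Prop :=
  exists s : seq gT, [/\ (size s <= d)%N, path (cay_adj S) g s & last g s = h].

(* diam(Gamma(G;S)) <= d (a disconnected graph has infinite diameter). *)
Definition diam_le (gT : finGroupType) (S : {set gT}) (d : nat) : Prop :=
  forall g h : gT, dist_le S d g h.

Definition prob_diam_gt (R : realType) (gT : finGroupType) (p : R) (d : nat) : R :=
  \sum_(S : {set gT} | ~~ `[< diam_le S d >]) p ^+ #|S| * (1 - p) ^+ (#|gT| - #|S|).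

Definition involutions (gT : finGroupType) : {set gT} :=
  [set x : gT | (x ^+ 2 == 1)%g].

Definition cl (gT : finGroupType) (x : gT) : nat := #|(x ^: [set: gT])%g|.

Definition small_class (R : realType) (gT : finGroupType) (M : R) : {set gT} :=
  [set x : gT | (cl x)%:R <= M].

Definition dN (R : realType) (gamma : R) (N : nat) : R :=
  (1 - gamma) * Num.sqrt (ln (N%:R) / (2 * ln (ln (N%:R)))).

Definition MN (R : realType) (N : nat) : R :=
  expR (2 * Num.sqrt (ln (N%:R) * ln (ln (N%:R)))).

Definition p_thr (R : realType) (eps : R) (d N : nat) : R :=
  (((1 + eps) / 2 ^+ d) * (ln (N%:R) / (N%:R) ^+ (d.-1))) `^ (d%:R)^-1.

(* Main.v *)
Require Import Defs.
From HB Require Import structures.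
From mathcomp Require Import all_boot all_order all_algebra all_fingroup.
From mathcomp Require Import boolp reals ring lra zify.
From mathcomp.analysis Require Import sequences exp.
Set Implicit Arguments. Unset Strict Implicit. Unset Printing Implicit Defensive.
Import Order.TTheory GRing.Theory Num.Theory.
Local Open Scope ring_scope.

(* Every x <> 1 has to be a product of d elements of S and their inverses.  The
   sets {a_1^e_1, ..., a_d^e_d} with x = a_1 ... a_d and exponents e_i = 1 or -1
   form a family to which Janson's inequality applies:
   its overlap term is negligible, so x is missed with probability about
   exp(-(1+eps) log N / m), where m bounds the number of factorizations having a
   given support.  Almost every factorization can be rearranged, with changed
   exponents, into another factorization of x only by a rotation, possibly
   followed by inversion: any other rearrangement forces, when a pair
   (a_i, a_(i+1)) is moved to (a_i z, z^-1 a_(i+1)), an equation in z which either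
   prescribes a square or prescribes the conjugate of a nearly uniform element,
   and both are rare because few elements have small conjugacy classes.
   Proper rotations are rare as well if cl(x) > M, and inversion is only possible
   if x is an involution, whence m = 1, 2, d or 2d.  Conditions (a)-(c) match
   these four values in the union bound over x. *)

Lemma leq_bool (b c : bool) : (b -> c) -> (b <= c)%N.
Proof. by case: b c => [] [] // /(_ isT). Qed.

(** * Random subsets and Janson's inequality *)

Section RandomSubset.
Variables (R : realType) (T : finType).
Implicit Types (q : T -> R) (S A B : {set T}) (f g : {set T} -> R).

(** The inclusion probability may vary with the element because [expect_antitone] changes it one
    element at a time. *)
Definition set_weight q S : R := \prod_x (if x \in S then q x else 1 - q x).
Definition expect q f : R := \sum_S set_weight q S * f S.

Lemma set_weight_const (p : R) S :
  set_weight (fun=> p) S = p ^+ #|S| * (1 - p) ^+ (#|T| - #|S|).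
Proof.
rewrite /set_weight (bigID (mem S)) /=.
rewrite (eq_bigr (fun=> p)); last by move=> x ->.
rewrite [X in _ * X](eq_bigr (fun=> 1 - p)); last by move=> x /negbTE ->.
rewrite !prodr_const -(cardC (mem S)); congr (_ * _ ^+ _).
by rewrite addKn; apply: eq_card.
Qed.

Lemma set_weight_ge0 q S : (forall x, 0 <= q x <= 1) -> 0 <= set_weight q S.
Proof.
move=> q01; apply: prodr_ge0 => x _.
by case: ifP => _; have /andP[? ?] := q01 x; rewrite ?subr_ge0.
Qed.

Lemma expect_const q (c : R) : expect q (fun=> c) = c.
Proof.
rewrite /expect -mulr_suml -[RHS]mul1r; congr (_ * _).
have := @bigA_distr R 0 1 *%R +%R T q (fun x => 1 - q x).
rewrite big1 => [->|x _]; first by apply: eq_bigl => S; rewrite inE.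
exact: subrKC.
Qed.

Lemma ler_expect q f g : (forall x, 0 <= q x <= 1) ->
  (forall S, f S <= g S) -> expect q f <= expect q g.
Proof.
by move=> q01 lefg; apply: ler_sum => S _; rewrite ler_wpM2l ?set_weight_ge0.
Qed.

Lemma expect_ge0 q f : (forall x, 0 <= q x <= 1) ->
  (forall S, 0 <= f S) -> 0 <= expect q f.
Proof.
by move=> q01 f0; apply: sumr_ge0 => S _; rewrite mulr_ge0 ?set_weight_ge0.
Qed.

Lemma expectD q f g : expect q (fun S => f S + g S) = expect q f + expect q g.
Proof. by rewrite -big_split; apply: eq_bigr => S _; rewrite mulrDr. Qed.

Lemma expectN q f : expect q (fun S => - f S) = - expect q f.
Proof. by rewrite -sumrN; apply: eq_bigr => S _; rewrite mulrN. Qed.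

Lemma expect_sum q (I : Type) (r : seq I) (P : pred I) (F : I -> {set T} -> R) :
  expect q (fun S => \sum_(i <- r | P i) F i S) =
  \sum_(i <- r | P i) expect q (F i).
Proof.
by rewrite exchange_big; apply: eq_bigr => S _; rewrite mulr_sumr.
Qed.

(** Conditions on everything except whether [a] is chosen, pairing each [S] without [a] with
    [a |: S]. *)
Lemma expect_split q (a : T) f :
  expect q f = \sum_(S : {set T} | a \notin S)
    (\prod_(x | x != a) (if x \in S then q x else 1 - q x)) *
    (q a * f (a |: S) + (1 - q a) * f S).
Proof.
rewrite /expect (bigID (fun S => a \notin S)) /= addrC.
rewrite (reindex_onto (fun S => a |: S) (fun S => S :\ a)) /=; last first.
  by move=> S; rewrite negbK => aS; rewrite setD1K.
rewrite (eq_bigl (fun S => a \notin S)); last first.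
  move=> S; rewrite setU11 /=; apply/eqP/idP => [<-|/setU1K //].
  by rewrite !inE eqxx.
rewrite -big_split /=; apply: eq_bigr => S aS.
rewrite /set_weight (bigD1 a) //= setU11 [X in _ + X * _](bigD1 a) //= (negbTE aS).
rewrite (eq_bigr (fun x => if x \in S then q x else 1 - q x)); last first.
  by move=> x xa; rewrite !inE (negbTE xa).
by ring.
Qed.

Lemma expect_mem q (a : T) f :
  expect q (fun S => (a \in S)%:R * f S) = q a * expect q (fun S => f (a |: S)).
Proof.
rewrite !(expect_split q a) mulr_sumr; apply: eq_bigr => S aS.
by rewrite setU11 (negbTE aS) setUA setUid mul1r mul0r; ring.
Qed.

(* Conditioning on [A \subset S] amounts to replacing [S] by [A :|: S]; this
   gives both the independence from the sets disjoint from [A] and the case of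
   Harris' inequality needed here. *)
Lemma expect_subset (p : R) A f :
  expect (fun=> p) (fun S => (A \subset S)%:R * f S) =
  p ^+ #|A| * expect (fun=> p) (fun S => f (A :|: S)).
Proof.
have [n] := ubnP #|A|; elim: n A f => // n IH A f ltAn.
have [->|[a aA]] := set_0Vmem A.
  rewrite cards0 expr0 mul1r; apply: eq_bigr => S _.
  by rewrite sub0set set0U mul1r.
rewrite (cardsD1 a) aA exprS -mulrA.
have := IH (A :\ a) (fun S => f (a |: S)).
have -> : (#|A :\ a| < n)%N by move: ltAn; rewrite (cardsD1 a) aA.
move=> /(_ isT).
rewrite (_ : expect _ (fun S => f (a |: _)) = expect (fun=> p) (fun S => f (A :|: S))); last first.
  by apply: eq_bigr => S _; rewrite setUA setD1K.
move=> <-.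
have := expect_mem (fun=> p) a (fun S => ((A :\ a) \subset S)%:R * f S).
rewrite (_ : expect _ (fun S => _ * f (a |: S)) =
  expect (fun=> p) (fun S => (A :\ a \subset S)%:R * f (a |: S))); last first.
  by apply: eq_bigr => S _; rewrite !subDset setUA setUid.
move=> <-; apply: eq_bigr => S _; congr (_ * _); rewrite mulrA -natrM mulnb.
by rewrite -[in LHS](setD1K aA) subUset sub1set.
Qed.

Lemma expect_antitone q q' f : (forall x, 0 <= q x <= q' x) ->
  (forall x, q' x <= 1) -> (forall S S', S \subset S' -> f S' <= f S) ->
  expect q' f <= expect q f.
Proof.
move=> qq' q1 fdec.
(* These hybrid weights interpolate between [q] (empty list) and [q'] (all of [T]). Adding [a] to
   the list changes each term of [expect_split] by a nonnegative multiple of [f (a |: S) - f S],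
   which is at most 0. *)
pose h (s : seq T) x := if x \in s then q' x else q x.
have hE : expect q' f = expect (h (enum T)) f.
  by apply: eq_bigr => S _; congr (_ * _); apply: eq_bigr => x _; rewrite /h mem_enum.
rewrite {}hE.
elim: (enum T) => [|a s IH]; first by [].
apply: le_trans IH.
rewrite !(expect_split _ a); apply: ler_sum => S aS.
rewrite [X in X * _ <= _](eq_bigr (fun x => if x \in S then h s x else 1 - h s x)); last first.
  by move=> x xa; rewrite /h inE (negbTE xa).
apply: ler_wpM2l.
  apply: prodr_ge0 => x _; have /andP[q0 qq] := qq' x; have := q1 x.
  by rewrite /h; do 2 case: ifP => _; lra.
have := fdec S (a |: S) (subsetUr _ _).
have /andP[_ qq] := qq' a.
have : h s a <= h (a :: s) a by rewrite /h inE eqxx /=; case: ifP.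
set u := h s a; set v := h _ a; nra.
Qed.

Definition avoids (W : seq {set T}) S : R := (~~ has (fun A => A \subset S) W)%:R.

Lemma avoids_antitone W S S' : S \subset S' -> avoids W S' <= avoids W S.
Proof.
move=> sSS'; rewrite /avoids ler_nat; apply/leq_bool; apply: contra => /hasP[A AW sAS].
by apply/hasP; exists A => //; apply: subset_trans sAS sSS'.
Qed.

(** One step of Janson's inequality. Let [E] be the members of [W] disjoint from [A]. The event
    [A \subset S] is independent of avoiding [E], Harris' inequality bounds the chance that
    [A :|: B \subset S] while [E] is avoided, and avoiding [E] is at least as likely as avoiding
    [W]. *)
Lemma expect_avoids_cons (p : R) A (W : seq {set T}) : 0 <= p <= 1 -> uniq (A :: W) ->
  \sum_(B <- W | ~~ [disjoint A & B]) p ^+ #|B :\: A| <= 1 ->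
  expect (fun=> p) (avoids (A :: W)) <=
  (1 - p ^+ #|A| * (1 - \sum_(B <- W | ~~ [disjoint A & B]) p ^+ #|B :\: A|)) *
  expect (fun=> p) (avoids W).
Proof.
rewrite cons_uniq => p01 /andP[AW uW]; set s := \sum_(B <- W | _) _ => s1.
have [p0 p1] := andP p01.
pose E := [seq B : {set T} <- W | [disjoint A & B]].
have sub_avoid S : avoids W S <= avoids E S.
  rewrite /avoids ler_nat; apply/leq_bool; apply: contra => /hasP[B].
  by rewrite mem_filter => /andP[_ BW] BS; apply/hasP; exists B.
(* If [S] contains [A] and avoids [E] but not [W], some [B] in [W] that meets [A] lies in [S]; its
   term in the sum makes up for the subtracted 1. *)
have key S : avoids (A :: W) S <= avoids W S - (A \subset S)%:R * avoids E S +
    \sum_(B <- W | ~~ [disjoint A & B]) (A :|: B \subset S)%:R * avoids E S.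
  have nn : 0 <= \sum_(B <- W | ~~ [disjoint A & B]) (A :|: B \subset S)%:R * avoids E S.
    by apply: sumr_ge0 => B _; rewrite /avoids -natrM ler0n.
  rewrite {1}/avoids /=; case: (boolP (A \subset S)) => AS /=; last first.
    by rewrite mul0r subr0 -/(avoids W S) lerDl.
  rewrite mul1r.
  have [hE|hE] := boolP (has (fun B : {set T} => B \subset S) E).
    have aE : avoids E S = 0 by rewrite /avoids hE.
    by move: nn; rewrite aE subr0 => nn; apply: addr_ge0 nn; rewrite /avoids ler0n.
  have aE : avoids E S = 1 by rewrite /avoids hE.
  have [hW|hW] := boolP (has (fun B : {set T} => B \subset S) W); last first.
    have aW : avoids W S = 1 by rewrite /avoids hW.
    by rewrite aW; move: nn; rewrite aE subrr add0r.
  have aW : avoids W S = 0 by rewrite /avoids hW.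
  have [B BW BS] := hasP hW.
  have nd : ~~ [disjoint A & B].
    apply: contra hE => dAB; apply/hasP; exists B => //.
    by rewrite mem_filter dAB.
  rewrite big_mkcond (bigD1_seq B) //= nd subUset AS BS /= aW aE mul1r sub0r addKr.
  by apply: sumr_ge0 => C _; case: ifP; rewrite ?mulr1.
apply: le_trans (ler_expect (fun=> p01) key) _.
rewrite !expectD expectN expect_subset expect_sum.
have indE : expect (fun=> p) (fun S => avoids E (A :|: S)) = expect (fun=> p) (avoids E).
  apply: eq_bigr => S _; congr (_ * (~~ _)%:R).
  apply: eq_in_has => B; rewrite mem_filter => /andP[dAB _].
  by rewrite -subDset (setDidPl _) // disjoint_sym.
have harris B : expect (fun=> p) (fun S => (A :|: B \subset S)%:R * avoids E S) <=
    p ^+ #|A| * p ^+ #|B :\: A| * expect (fun=> p) (avoids E).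
  rewrite expect_subset cardsU -exprD.
  rewrite (_ : #|A| + #|B :\: A| = #|A| + #|B| - #|A :&: B|)%N; last first.
    by rewrite cardsD setIC addnBA // subset_leq_card ?subsetIr.
  apply: ler_wpM2l; first exact: exprn_ge0.
  by apply: ler_expect => // S; apply: avoids_antitone; apply: subsetUr.
have le_sum : \sum_(B <- W | ~~ [disjoint A & B])
    expect (fun=> p) (fun S => (A :|: B \subset S)%:R * avoids E S) <=
    p ^+ #|A| * s * expect (fun=> p) (avoids E).
  rewrite [leRHS]mulrAC /s mulr_sumr; apply: ler_sum => B _; rewrite [leRHS]mulrAC; exact: harris.
rewrite indE.
have leWE : expect (fun=> p) (avoids W) <= expect (fun=> p) (avoids E).
  by apply: ler_expect.
have pA : 0 <= p ^+ #|A| by exact: exprn_ge0.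
move: le_sum leWE pA; rewrite -/s.
set x := \sum_(B <- _ | _) _; set w := expect _ (avoids W); set e := expect _ _.
set t := p ^+ _ => xs we t0.
have : 0 <= t * (1 - s) * (e - w) by rewrite !mulr_ge0 ?subr_ge0.
by nra.
Qed.

(** Multiplies the one-step bounds along [W], using [1 - u <= expR (- u)]. As [p ^+ #|B :\: A|] is
    the probability of [B \subset S] given [A \subset S], [rho] bounds the conditional expected
    number of other sets that meet [A] and lie in [S]. *)
Lemma janson (p rho : R) (k : nat) (W : seq {set T}) : 0 <= p <= 1 -> uniq W ->
  rho <= 1 -> (forall A, A \in W -> #|A| = k) ->
  (forall A, A \in W ->
    \sum_(B <- W | (B != A) && ~~ [disjoint A & B]) p ^+ #|B :\: A| <= rho) ->
  expect (fun=> p) (avoids W) <= expR (- ((size W)%:R * p ^+ k * (1 - rho))).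
Proof.
move=> p01 + rho1; elim: W => [_ _ _|A W IH uW cW sW].
  by rewrite /avoids expect_const !mul0r oppr0 expR0.
have [p0 p1] := andP p01.
have [AW uW'] := andP uW.
have sA : \sum_(B <- W | ~~ [disjoint A & B]) p ^+ #|B :\: A| <= rho.
  have := sW A (mem_head _ _); rewrite big_cons eqxx /=; apply: le_trans.
  rewrite le_eqVlt; apply/orP; left; apply/eqP.
  rewrite big_seq_cond [RHS]big_seq_cond; apply: eq_bigl => B.
  by case: (boolP (B \in W)) => //= BW; rewrite (memPn AW).
apply: le_trans (expect_avoids_cons p01 uW (le_trans sA rho1)) _.
rewrite [size _]/= [X in expR X](_ : _ = - ((size W)%:R * p ^+ k * (1 - rho)) + - (p ^+ k * (1 - rho))); last first.
  by rewrite -natr1; ring.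
rewrite expRD mulrC.
apply: ler_pM.
- by apply: expect_ge0 => // S; rewrite /avoids.
- by rewrite subr_ge0 mulr_ile1 ?exprn_ge0 ?exprn_ile1 ?subr_ge0 ?(le_trans sA) //
    lerBlDr lerDl sumr_ge0 // => B _; rewrite exprn_ge0.
- apply: IH => // [B BW|B BW]; first by apply: cW; rewrite inE BW orbT.
  have := sW B; rewrite inE BW orbT => /(_ isT); apply: le_trans.
  by rewrite [leRHS]big_cons; case: ifP => // _; rewrite lerDr exprn_ge0.
- apply: le_trans (expR_ge1Dx _).
  rewrite cW ?mem_head // lerD2l lerN2 ler_wpM2l ?exprn_ge0 // lerD2l lerN2.
  exact: sA.
Qed.

End RandomSubset.

(** * Double counting along families of permutations *)

Local Open Scope nat_scope.

Lemma sum_shift (gT A : finType) (E : {set A}) (T : gT -> A -> A) (F : A -> nat) :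
  (forall z, injective (T z)) -> (forall z a, (T z a \in E) = (a \in E)) ->
  (\sum_(a in E) \sum_z F (T z a) = #|gT| * \sum_(a in E) F a)%N.
Proof.
move=> Tinj TE; rewrite exchange_big /= -[RHS]sum_nat_const.
apply: eq_bigr => z _; rewrite [RHS](reindex_inj (Tinj z)) /=.
by apply: eq_bigl => a; rewrite TE.
Qed.

Lemma sum_nat_pred (A : finType) (E : {set A}) (P : pred A) :
  (\sum_(a in E) (P a : nat) = #|[set a in E | P a]|)%N.
Proof.
rewrite -sum1_card big_mkcond [RHS]big_mkcond /=; apply: eq_bigr => a _.
by rewrite inE; case: (a \in E) (P a) => [] [].
Qed.

Lemma sum_nat_pred1 (A : finType) (P : pred A) :
  (\sum_a (P a : nat) = #|[set a | P a]|)%N.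
Proof.
rewrite -sum1_card big_mkcond [RHS]big_mkcond /=; apply: eq_bigr => a _.
by rewrite inE; case: (P a).
Qed.

(** Each [T z] permutes [E], so the proportion of [E] satisfying [P] is the average over [a] of the
    proportion of [z] with [P (T z a)]. Rarity of an event thus reduces to counting the solutions
    [z] of an equation. *)
Lemma count_shift (gT A : finType) (E : {set A}) (T : gT -> A -> A) (P : pred A) D :
  (forall z, injective (T z)) -> (forall z a, (T z a \in E) = (a \in E)) ->
  (forall a, a \in E -> #|[set z | P (T z a)]| <= D)%N ->
  (#|gT| * #|[set a in E | P a]| <= D * #|E|)%N.
Proof.
move=> Tinj TE PD; rewrite -sum_nat_pred -(sum_shift _ Tinj TE).
rewrite mulnC -sum_nat_const; apply: leq_sum => a aE.
by rewrite sum_nat_pred1 PD.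
Qed.

Lemma card_le1_inj (A B : finType) (f : A -> B) (y : B) : injective f ->
  (#|[set z | f z == y]| <= 1)%N.
Proof.
move=> finj; apply/card_le1_eqP => z z'; rewrite !inE => /eqP zy /eqP z'y.
by apply: finj; rewrite zy z'y.
Qed.

(** * Signed words in the entries of a tuple *)

Section SignedWords.
Variables (gT : finGroupType) (d : nat).
Local Open Scope group_scope.
Implicit Types (x y z v : gT) (a : {ffun 'I_d -> gT}) (l : seq ('I_d * bool)).

Definition sgn (b : bool) y := if b then y else y^-1.
Definition eval a l := \prod_(q <- l) sgn q.2 (a q.1).
Definition id_word : seq ('I_d * bool) := [seq (i, true) | i <- enum 'I_d].
Definition inv_word l := rev [seq (q.1, ~~ q.2) | q <- l].
Definition factorizations x := [set a | eval a id_word == x].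

Lemma sgn_inj b : injective (sgn b).
Proof. by case: b => //; exact: invg_inj. Qed.

Lemma sgnN b y : sgn (~~ b) y = (sgn b y)^-1.
Proof. by case: b => //=; rewrite invgK. Qed.

Lemma sgn_sgn b b' y : sgn b (sgn b' y) = sgn (b == b') y.
Proof. by case: b b' => [] []; rewrite //= invgK. Qed.

Lemma eval_cat a l1 l2 : eval a (l1 ++ l2) = eval a l1 * eval a l2.
Proof. by rewrite /eval big_cat. Qed.

Lemma eval_cons a q l : eval a (q :: l) = sgn q.2 (a q.1) * eval a l.
Proof. by rewrite /eval big_cons. Qed.

Lemma eval_nil a : eval a [::] = 1.
Proof. by rewrite /eval big_nil. Qed.

Definition evalE := (eval_cat, eval_cons, eval_nil, @mulg1 gT).

Lemma eval_inv_word a l : eval a (inv_word l) = (eval a l)^-1.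
Proof.
elim: l => [|q l IH]; first by rewrite !evalE invg1.
by rewrite /inv_word map_cons rev_cons -cats1 -/(inv_word l) !evalE IH invMg sgnN.
Qed.

Lemma eq_eval a a' l : {in unzip1 l, a =1 a'} -> eval a l = eval a' l.
Proof.
move=> aa'; rewrite /eval !big_seq; apply: eq_bigr => q ql.
by rewrite aa' // map_f.
Qed.

Lemma unzip1_inv_word l : unzip1 (inv_word l) = rev (unzip1 l).
Proof. by rewrite /unzip1 map_rev -map_comp. Qed.

Lemma inv_wordK l : inv_word (inv_word l) = l.
Proof.
rewrite /inv_word map_rev revK -map_comp -[RHS]map_id.
by apply: eq_map => -[i b] /=; rewrite negbK.
Qed.

Lemma mem_inv_word l i b : ((i, b) \in inv_word l) = ((i, ~~ b) \in l).
Proof.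
apply/idP/idP; last first.
  by rewrite mem_rev => il; apply/mapP; exists (i, ~~ b); rewrite //= negbK.
by rewrite mem_rev => /mapP[[k c] kl [-> ->]]; rewrite /= negbK.
Qed.

(** Two ways to move a tuple: [shift1] makes the value of a word containing [k] exactly once run
    through the whole group, while [shift2] with [j = i + 1] preserves the full product and hence
    acts on the factorizations of [x]. *)
Definition shift1 (k : 'I_d) z a : {ffun 'I_d -> gT} :=
  [ffun i => if i == k then a i * z else a i].
Definition shift2 (i j : 'I_d) z a : {ffun 'I_d -> gT} :=
  [ffun k => if k == i then a k * z else if k == j then z^-1 * a k else a k].

Lemma shift1_inj k z : injective (shift1 k z).
Proof.
move=> a b /ffunP ab; apply/ffunP => i; have := ab i.
by rewrite !ffunE; case: ifP => // _; exact: mulIg.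
Qed.

Lemma shift2_inj i j z : injective (shift2 i j z).
Proof.
move=> a b /ffunP ab; apply/ffunP => k; have := ab k.
rewrite !ffunE; case: ifP => _; first exact: mulIg.
by case: ifP => // _; exact: mulgI.
Qed.

Lemma eval_shift1_out k z a l : k \notin unzip1 l -> eval (shift1 k z a) l = eval a l.
Proof.
move=> kl; apply: eq_eval => i il; rewrite ffunE; case: eqP => // ik.
by rewrite -ik il in kl.
Qed.

Lemma eval_shift2_out i j z a l : i \notin unzip1 l -> j \notin unzip1 l ->
  eval (shift2 i j z a) l = eval a l.
Proof.
move=> il jl; apply: eq_eval => k kl; rewrite ffunE.
by case: eqP => [ki|_]; [rewrite -ki kl in il|case: eqP => // kj; rewrite -kj kl in jl].
Qed.

Lemma split_word l (i : 'I_d) : i \in unzip1 l ->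
  exists b l1 l2, l = l1 ++ (i, b) :: l2.
Proof.
move=> /mapP[[k b] kl /= ->]; exists b.
by case/splitPr: kl => l1 l2; exists l1, l2.
Qed.

Lemma eval_shift1_inj k a l : uniq (unzip1 l) -> k \in unzip1 l ->
  injective (fun z => eval (shift1 k z a) l).
Proof.
move=> + kl; have [b [l1 [l2 ->]]] := split_word kl.
rewrite /unzip1 map_cat cat_uniq /= => /and3P[_ /norP[k1 _] /andP[k2 _]] z z'.
rewrite !evalE !(eval_shift1_out _ _ k1) !(eval_shift1_out _ _ k2) => /mulgI /mulIg /sgn_inj.
by rewrite !ffunE eqxx => /mulgI.
Qed.

Lemma id_word_split (i j : 'I_d) : j = i.+1 :> nat ->
  exists l1 l2, id_word = l1 ++ (i, true) :: (j, true) :: l2 /\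
  [/\ i \notin unzip1 l1, j \notin unzip1 l1, i \notin unzip1 l2 & j \notin unzip1 l2].
Proof.
move=> ij; pose s := enum 'I_d.
have ss : size s = d by rewrite size_enum_ord.
have es : s = take i s ++ i :: j :: drop j.+1 s.
  rewrite -[LHS](cat_take_drop i); congr (_ ++ _).
  rewrite (drop_nth i) ?ss // -ij (drop_nth i) ?ss //.
  by congr [:: _, _ & _]; apply: val_inj; rewrite /= nth_enum_ord.
have us : uniq s by exact: enum_uniq.
exists [seq (k, true) | k <- take i s], [seq (k, true) | k <- drop j.+1 s].
rewrite /id_word -/s {1}es map_cat; split=> //.
have m1 (r : seq 'I_d) : unzip1 [seq (k, true) | k <- r] = r.
  by rewrite /unzip1 -map_comp map_id.
rewrite !m1; move: us; rewrite {1}es cat_uniq => /and3P[_ /hasPn h /= /and3P[]].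
rewrite inE negb_or => /andP[_ i2] j2 _; split=> //.
  by apply: h; rewrite inE eqxx.
by apply: h; rewrite !inE eqxx orbT.
Qed.

Lemma eval_id_shift2 (i j : 'I_d) z a : j = i.+1 :> nat ->
  eval (shift2 i j z a) id_word = eval a id_word.
Proof.
move=> ij; have [l1 [l2 [-> [i1 j1 i2 j2]]]] := id_word_split ij.
rewrite !evalE /= !eval_shift2_out // !ffunE !eqxx.
have /negbTE -> : j != i by rewrite -val_eqE /= ij; lia.
by rewrite -!mulgA; congr (_ * (_ * _)); rewrite !mulgA mulgV mul1g.
Qed.

Lemma unzip1_id_word : unzip1 id_word = enum 'I_d.
Proof. by rewrite /unzip1 -map_comp map_id. Qed.

Lemma eval_id_shift1_card k a x : #|[set z | eval (shift1 k z a) id_word == x]| = 1%N.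
Proof.
have uid : uniq (unzip1 id_word) by rewrite unzip1_id_word enum_uniq.
have kid : k \in unzip1 id_word by rewrite unzip1_id_word mem_enum.
have [h hK Kh] := injF_bij (eval_shift1_inj (a := a) uid kid).
rewrite -(cards1 (h x)); apply: eq_card => z; rewrite !inE.
by apply/eqP/eqP => [<-|->]; rewrite ?hK ?Kh.
Qed.

(** Each orbit of [shift1 m] contains exactly one factorization of [x], so a function blind to
    coordinate [m] has the same average over the factorizations as over all tuples. *)
Lemma sum_factorizations m x (F : {ffun 'I_d -> gT} -> nat) :
  (forall z a, F (shift1 m z a) = F a) ->
  (#|gT| * \sum_(a in factorizations x) F a = \sum_a F a)%N.
Proof.
move=> Fm; pose G a := ((a \in factorizations x) * F a)%N.
transitivity (#|gT| * \sum_(a in [set: {ffun 'I_d -> gT}]) G a)%N.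
  congr (_ * _)%N; rewrite big_mkcond /=; apply: eq_big => [a|a _]; first by rewrite inE.
  by rewrite /G; case: ifP; rewrite ?mul1n ?mul0n.
rewrite -(sum_shift _ (@shift1_inj m)) => [|z a]; last by rewrite !inE.
apply: eq_big => [a|a _]; first by rewrite inE.
rewrite /G (eq_bigr (fun z => (eval (shift1 m z a) id_word == x) * F a)%N); last first.
  by move=> z _; rewrite Fm inE.
by rewrite -big_distrl /= sum_nat_pred1 eval_id_shift1_card mul1n.
Qed.

Lemma card_factorizations (m : 'I_d) x :
  (#|gT| * #|factorizations x| = #|gT| ^ d)%N.
Proof.
rewrite -sum1_card (@sum_factorizations m x (fun=> 1%N)) // sum1_card card_ffun card_ord //.
Qed.
End SignedWords.

(** * Equations that few factorizations satisfy *)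

Lemma uniq_split2 (T : eqType) (s0 s1 s2 : seq T) u v :
  uniq (s0 ++ u :: s1 ++ v :: s2) ->
  [/\ uniq s1, [/\ u \notin s0, u \notin s1 & u \notin s2],
      [/\ v \notin s0, v \notin s1 & v \notin s2], u != v &
      forall w, (w \in s0) || (w \in s2) -> w \notin s1].
Proof.
rewrite cat_uniq /= => /and3P[_ /norP[u0]].
rewrite has_cat /= => /norP[h1 /norP[v0 h2]] /andP[].
rewrite mem_cat inE => /norP[u1 /norP[uv u2]].
rewrite cat_uniq /= => /and3P[us1 /norP[v1 h12] /andP[v2 _]]; split=> // w.
case/orP=> [w0|w2]; last exact: (hasPn h12).
by apply: contraL w0 => w1; exact: (hasPn h1).
Qed.

Lemma index_split2 (T : eqType) (s0 s1 s2 : seq T) u v :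
  uniq (s0 ++ u :: s1 ++ v :: s2) ->
  index u (s0 ++ u :: s1 ++ v :: s2) = size s0 /\
  index v (s0 ++ u :: s1 ++ v :: s2) = size s0 + (size s1).+1.
Proof.
move=> /uniq_split2[_ [u0 _ _] [v0 v1 _] uv _].
by rewrite !index_cat (negbTE u0) (negbTE v0) /= eqxx (negbTE uv) index_cat
  (negbTE v1) /= eqxx !addn0.
Qed.

Local Open Scope group_scope.
(** The solutions, if there are any, form a coset of the centralizer of [c]. *)
Lemma card_conj_le (gT : finGroupType) (c v : gT) :
  #|[set z : gT | z^-1 * c * z == v]| <= #|'C[c]|.
Proof.
have [->|[z0]] := set_0Vmem [set z : gT | z^-1 * c * z == v]; first by rewrite cards0.
rewrite inE => /eqP z0v; rewrite -(card_imset _ (mulIg z0^-1)).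
apply: subset_leq_card; apply/subsetP => _ /imsetP[z + ->]; rewrite inE => /eqP zv.
have e1 : c * z = z * v by rewrite -zv !mulgA mulgV mul1g.
have e0 : z0^-1 * c = v * z0^-1 by rewrite -z0v mulgK.
by apply/cent1P; rewrite /commute -mulgA e0 !mulgA e1.
Qed.

Lemma card_conjV_le (gT : finGroupType) (c v : gT) :
  #|[set z : gT | z * c * z^-1 == v]| <= #|'C[c]|.
Proof.
apply: leq_trans (card_conj_le c v); rewrite -(card_imset _ (@invg_inj gT)).
apply: subset_leq_card; apply/subsetP => _ /imsetP[z + ->].
by rewrite !inE invgK.
Qed.

Section Counting.
Variables (gT : finGroupType) (d D : nat).
Implicit Types (x y z v : gT) (a : {ffun 'I_d -> gT}) (l : seq ('I_d * bool)).
(** [D / #|gT|] is the small proportion in all counts below. It bounds the fraction of square roots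
    of any element and, through the average centralizer order, the chance that a random conjugate of
    a uniform element takes a prescribed value. *)
Hypothesis roots_le : forall c : gT, #|[set y : gT | y * y == c]| <= D.
Hypothesis centralizers_le : (\sum_(v : gT) #|'C[v]| <= D * #|gT|)%N.

(** The equation says that [z * c] is a square root of [e * c]. *)
Lemma card_square_eq_le (c e : gT) : #|[set z | z * c * z == e]| <= D.
Proof.
apply: leq_trans (roots_le (e * c)); rewrite -[leqLHS](card_imset _ (mulIg c)).
apply: subset_leq_card; apply/subsetP => _ /imsetP[z + ->]; rewrite !inE => /eqP <-.
by rewrite !mulgA.
Qed.

Lemma finGroup_card_gt0 : (0 < #|gT|)%N.
Proof. by apply/card_gt0P; exists 1. Qed.

(** The index [m] missing from [l] is used to drop the condition that the product be [x]; the index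
    [k] occurring in [l] then makes the value of [l] uniform. *)
Lemma sum_centralizers l (m k : 'I_d) x : m \notin unzip1 l -> k \in unzip1 l ->
  uniq (unzip1 l) ->
  (\sum_(a in factorizations d x) #|'C[eval a l]| <= D * #|factorizations d x|)%N.
Proof.
move=> ml kl ul; have N0 := finGroup_card_gt0.
rewrite -(leq_pmul2l N0) (sum_factorizations (m := m)); last first.
  by move=> z a; rewrite eval_shift1_out.
rewrite mulnCA (card_factorizations m) -(leq_pmul2l N0).
have -> : (\sum_(a : {ffun 'I_d -> gT}) #|'C[eval a l]| =
    \sum_(a in [set: {ffun 'I_d -> gT}]) #|'C[eval a l]|)%N.
  by rewrite [RHS]big_mkcond; apply: eq_bigr => a _; rewrite inE.
rewrite -(sum_shift _ (@shift1_inj gT d k)); last by move=> z a; rewrite !inE.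
apply: (@leq_trans (\sum_(a in [set: {ffun 'I_d -> gT}]) D * #|gT|)%N).
  apply: leq_sum => a _; apply: leq_trans centralizers_le.
  by rewrite [leqRHS](reindex_inj (eval_shift1_inj (a := a) ul kl)).
rewrite sum_nat_const cardsT card_ffun card_ord; set n := (_ ^ _)%N; nia.
Qed.

Section Pair.
Variables (i j : 'I_d) (x v : gT).
Hypothesis ij : j = i.+1 :> nat.

Lemma shift2_factorizations z a :
  (shift2 i j z a \in factorizations d x) = (a \in factorizations d x).
Proof. by rewrite !inE eval_id_shift2. Qed.

Lemma count_by_roots l :
  (forall a, exists b c e, forall z,
    eval (shift2 i j z a) l = b * (z * c * z) * e) ->
  (#|gT| * #|[set a in factorizations d x | eval a l == v]| <=
   D * #|factorizations d x|)%N.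
Proof.
move=> H; apply: (count_shift (@shift2_inj gT d i j) shift2_factorizations) => a _.
have [b [c [e Hz]]] := H a.
apply: leq_trans (card_square_eq_le c (b^-1 * v * e^-1)).
apply: subset_leq_card; apply/subsetP => z; rewrite !inE Hz => /eqP <-.
by rewrite !mulgA mulVg mul1g mulgK.
Qed.

(** Here the number of solutions [z] has no useful bound for a single [a], only on average over
    [a]. *)
Lemma count_by_centralizers l l' (m k : 'I_d) :
  m \notin unzip1 l' -> k \in unzip1 l' -> uniq (unzip1 l') ->
  (forall a, (#|[set z | eval (shift2 i j z a) l == v]| <= #|'C[eval a l']|)%N) ->
  (#|gT| * #|[set a in factorizations d x | eval a l == v]| <=
   D * #|factorizations d x|)%N.
Proof.
move=> ml kl ul H; apply: leq_trans (sum_centralizers x ml kl ul).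
rewrite -sum_nat_pred -(sum_shift _ (@shift2_inj gT d i j) shift2_factorizations).
by apply: leq_sum => a _; rewrite sum_nat_pred1.
Qed.

Lemma shift2_i z a : shift2 i j z a i = a i * z.
Proof. by rewrite ffunE eqxx. Qed.

Lemma shift2_j z a : shift2 i j z a j = z^-1 * a j.
Proof. by rewrite ffunE eqxx; case: eqP => // ji; move: ij; rewrite ji; lia. Qed.

(* Under [shift2] the equation becomes [z * c * z = e] if the exponents of [i]
   and [j] differ, and otherwise it prescribes the conjugate by [z] of a subword
   of [l], which is equidistributed unless it is trivial or the whole of [l]. *)
Lemma count_nonadjacent (strict : bool) l b : uniq (unzip1 l) -> size l = d ->
  (i, true) \in l -> (j, b) \in l -> (strict -> #|'C[v]| <= D)%N ->
  ~~ [&& b & (index j (unzip1 l) == (index i (unzip1 l)).+1) ||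
     [&& ~~ strict, index j (unzip1 l) == 0%N & index i (unzip1 l) == d.-1]] ->
  (#|gT| * #|[set a in factorizations d x | eval a l == v]| <=
   D * #|factorizations d x|)%N.
Proof.
move=> ul sl il jl CD nadj.
have nij : i != j by apply/eqP => eij; move: ij; rewrite eij; lia.
have cases : (exists l0 l1 l2, l = l0 ++ (i, true) :: l1 ++ (j, b) :: l2) \/
    (exists l0 l1 l2, l = l0 ++ (j, b) :: l1 ++ (i, true) :: l2).
  case/splitPr: il jl => l0 l2.
  rewrite mem_cat inE xpair_eqE eq_sym (negbTE nij) /= => /orP[] jl.
    by case/splitPr: jl => l1 l1'; right; exists l1, l1', l2; rewrite -catA.
  by case/splitPr: jl => l1 l1'; left; exists l0, l1, l1'.
case: cases => -[l0 [l1 [l2 el]]]; rewrite {l}el in ul sl il jl nadj *; move: ul sl nadj {il jl};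
  rewrite /unzip1 map_cat map_cons map_cat map_cons -!/unzip1 /= => ul sl;
  have [p1 p2] := index_split2 ul; rewrite {}p1 {}p2 => nadj.
- have [u1 [i0 i1 i2] [j0 j1 j2] _ _] := uniq_split2 ul.
  have evs z a : eval (shift2 i j z a) (l0 ++ (i, true) :: l1 ++ (j, b) :: l2) =
     eval a l0 * (a i * z) * (eval a l1 * sgn b (z^-1 * a j)) * eval a l2.
    by rewrite !evalE !eval_shift2_out // shift2_i shift2_j !mulgA.
  case: b evs nadj {sl ul} => /= evs nadj; last first.
    apply: count_by_roots => a.
    exists (eval a l0 * a i), (eval a l1 * (a j)^-1), (eval a l2) => z.
    by rewrite evs invMg invgK !mulgA.
  (* As [i] and [j] are not adjacent, [l1] is nonempty; it is the subword conjugated by [z], and [i]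
     is an index that it omits. *)
  have [k k1] : exists k, k \in unzip1 l1.
    case: (unzip1 l1) nadj => [|k s]; first by rewrite /= addn1 eqxx.
    by move=> _; exists k; rewrite mem_head.
  apply: (count_by_centralizers i1 k1 u1) => a.
  apply: leq_trans (card_conjV_le _ ((eval a l0 * a i)^-1 * v * (a j * eval a l2)^-1)).
  apply: subset_leq_card; apply/subsetP => z; rewrite !inE evs => /eqP <-.
  by rewrite !invMg -!mulgA !(mulKg, mulVKg, mulgV, mulVg, mulg1, mul1g).
have [u1 [j0 j1 j2] [i0 i1 i2] _ disj] := uniq_split2 ul.
have evs z a : eval (shift2 i j z a) (l0 ++ (j, b) :: l1 ++ (i, true) :: l2) =
   eval a l0 * sgn b (z^-1 * a j) * (eval a l1 * (a i * z)) * eval a l2.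
  by rewrite !evalE !eval_shift2_out // shift2_i shift2_j !mulgA.
case: b evs nadj sl => /= evs nadj sl; last first.
  apply: count_by_roots => a.
  exists (eval a l0 * (a j)^-1), (eval a l1 * a i), (eval a l2) => z.
  by rewrite evs invMg invgK !mulgA.
have conj a z : eval (shift2 i j z a) (l0 ++ (j, true) :: l1 ++ (i, true) :: l2) =
   eval a l0 * (z^-1 * eval a ((j, true) :: l1 ++ [:: (i, true)]) * z) * eval a l2.
  by rewrite evs !evalE /= !mulgA.
have [l02|[m m02]] : (l0 = [::] /\ l2 = [::]) \/ 
    (exists m, (m \in unzip1 l0) || (m \in unzip1 l2)).
- case: {sl evs conj ul disj nadj i0 j0} l0 => [|q l0]; last first.
    by right; exists q.1; rewrite inE eqxx.
  case: {i2 j2} l2 => [|q l2]; first by left.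
  by right; exists q.1; rewrite inE eqxx orbT.
(* The conjugated subword is all of [l], so no index is left over. This is the wrap-around, hence
   [strict] holds, and the solutions [z] are counted by the centralizer of the target [v]
   instead. *)
- case: l02 => el0 el2; subst l0 l2.
  have st : strict.
    apply: contraNT nadj => ns; apply/orP; right; rewrite ns /=.
    by move: sl; rewrite /= size_cat /= size_map; lia.
  apply: (count_shift (@shift2_inj gT d i j) shift2_factorizations) => a _.
  apply: leq_trans (CD st).
  apply: leq_trans (card_conjV_le v (eval a ((j, true) :: l1 ++ [:: (i, true)]))).
  apply: subset_leq_card; apply/subsetP => z; rewrite !inE conj !evalE => /eqP <-.
  by rewrite ?invMg -!mulgA !(mulKg, mulVKg, mulgV, mulVg, mulg1, mul1g).
have ml : m \notin unzip1 ((j, true) :: l1 ++ [:: (i, true)]).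
  rewrite /unzip1 map_cons map_cat -/unzip1 inE mem_cat inE /=.
  rewrite (negbTE (disj _ m02)) /= negb_or.
  by apply/andP; split; apply: contraTneq m02 => ->; rewrite negb_or ?j0 ?j2 ?i0 ?i2.
have jl : j \in unzip1 ((j, true) :: l1 ++ [:: (i, true)]) by rewrite inE eqxx.
have ul' : uniq (unzip1 ((j, true) :: l1 ++ [:: (i, true)])).
  rewrite /unzip1 map_cons map_cat -/unzip1 /= mem_cat negb_or j1 inE eq_sym nij /=.
  by rewrite cat_uniq u1 /= orbF andbT; exact: i1.
apply: (count_by_centralizers ml jl ul') => a.
apply: leq_trans (card_conj_le _ ((eval a l0)^-1 * v * (eval a l2)^-1)).
apply: subset_leq_card; apply/subsetP => z; rewrite !inE conj => /eqP <-.
by rewrite ?invMg -!mulgA !(mulKg, mulVKg, mulgV, mulVg, mulg1, mul1g).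
Qed.
End Pair.
End Counting.

Lemma card_cover_le (A I : finType) (X : {set A}) (B : I -> {set A}) (K : nat) :
  (forall x, x \in X -> exists i, x \in B i) -> (forall i, #|B i| <= K) ->
  #|X| <= (#|I| * K)%N.
Proof.
move=> XB BK; apply: (@leq_trans (\sum_i #|B i|)); last first.
  by rewrite -sum_nat_const; apply: leq_sum => i _.
have -> : \sum_i #|B i| = \sum_i \sum_x (x \in B i : nat).
  by apply: eq_bigr => i _; rewrite -sum1_card big_mkcond; apply: eq_bigr => x _; case: ifP.
rewrite exchange_big /= -sum1_card big_mkcond; apply: leq_sum => x _.
case: ifP => // /XB[i xi]; rewrite (bigD1 i) //= xi; lia.
Qed.

(** * Rearrangements by rotation and inversion *)

Section Compatible.
Variables (gT : finGroupType) (d : nat).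
Implicit Types (x y z v : gT) (a : {ffun 'I_d -> gT}) (l : seq ('I_d * bool)).

(* [strict] forbids the cyclic wrap-around; it is imposed for large classes. *)
Definition adjacent (strict : bool) l (i j : 'I_d) :=
  (index j (unzip1 l) == (index i (unzip1 l)).+1) ||
  [&& ~~ strict, index j (unzip1 l) == 0%N & index i (unzip1 l) == d.-1].

(** For words using each index once, this singles out the rotations of [id_word] and their inverses,
    or only [id_word] and its inverse if [strict] holds. In such a word [(i, true) \in l] encodes
    the exponent of [i]. *)
Definition compatible strict l :=
  [forall i : 'I_d, forall j : 'I_d, (j == i.+1 :> nat) ==>
    (((i, true) \in l) == ((j, true) \in l)) &&
    adjacent strict (if (i, true) \in l then l else inv_word l) i j].

Definition arrangements a x : {set d.-tuple ('I_d * bool)} :=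
  [set l : d.-tuple ('I_d * bool) | uniq (unzip1 l) && (eval a l == x)].

Lemma mem_unzip1_full l (i : 'I_d) : uniq (unzip1 l) -> size l = d -> i \in unzip1 l.
Proof.
move=> ul sl; have sub : {subset unzip1 l <= enum 'I_d} by move=> k _; rewrite mem_enum.
have le : size (enum 'I_d) <= size (unzip1 l) by rewrite size_enum_ord size_map sl.
by have [_ ->] := uniq_min_size ul sub le; rewrite mem_enum.
Qed.

Lemma mem_signed l (i : 'I_d) : uniq (unzip1 l) -> size l = d ->
  (i, (i, true) \in l) \in l.
Proof.
move=> ul sl; case: (boolP ((i, true) \in l)) => // il.
have /mapP[[k b] kl /= ik] := mem_unzip1_full i ul sl.
by case: b kl; rewrite -ik => // kl; rewrite kl in il.
Qed.

Lemma mem_signed_inj l (i : 'I_d) b b' : uniq (unzip1 l) ->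
  (i, b) \in l -> (i, b') \in l -> b = b'.
Proof.
move=> ul ib ib'; case/splitPr: ib ul ib' => l1 l2.
rewrite /unzip1 map_cat cat_uniq /= => /and3P[_ /norP[i1 _] /andP[i2 _]].
rewrite mem_cat inE xpair_eqE eqxx /= => /or3P[h|/eqP//|h].
  by move: i1; rewrite (map_f fst h).
by move: i2; rewrite (map_f fst h).
Qed.

Section Multiplicity.
Hypothesis d_gt0 : (0 < d)%N.
Let i0 : 'I_d := Ordinal d_gt0.
Definition positive_word l := if (i0, true) \in l then l else inv_word l.

Lemma positive_word_uniq l : uniq (unzip1 l) -> uniq (unzip1 (positive_word l)).
Proof. by rewrite /positive_word; case: ifP; rewrite ?unzip1_inv_word ?rev_uniq. Qed.

Lemma size_positive_word l : size (positive_word l) = size l.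
Proof. by rewrite /positive_word; case: ifP; rewrite ?size_rev ?size_map. Qed.

Lemma compatible_sign strict l (i : 'I_d) : compatible strict l ->
  ((i, true) \in l) = ((i0, true) \in l).
Proof.
move=> /forallP cl; case: i => n; elim: n => [|n IH] nd.
  by have -> : Ordinal nd = i0 by apply: val_inj.
have nd' : (n < d)%N by lia.
rewrite -(IH nd'); have /forallP/(_ (Ordinal nd)) := cl (Ordinal nd').
by rewrite /= eqxx /= => /andP[/eqP -> _].
Qed.

Lemma compatible_positive strict l : uniq (unzip1 l) -> size l = d ->
  compatible strict l -> forall i, (i, true) \in positive_word l.
Proof.
move=> ul sl cl i; rewrite /positive_word; have := compatible_sign i cl.
case: ifP => // _ il; rewrite mem_inv_word /=.
by have := mem_signed i ul sl; rewrite il.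
Qed.

(** Induction on [i]: each index stands right after its predecessor, cyclically, so the position of
    index 0 determines the rotation. *)
Lemma compatible_index strict l (i : 'I_d) : uniq (unzip1 l) -> size l = d ->
  compatible strict l ->
  index i (unzip1 (positive_word l)) =
  ((index i0 (unzip1 (positive_word l)) + i) %% d)%N /\
  (strict -> index i (unzip1 (positive_word l)) =
     (index i0 (unzip1 (positive_word l)) + i)%N).
Proof.
move=> ul sl cl; have idx k : (index k (unzip1 (positive_word l)) < d)%N.
  rewrite -[X in (_ < X)%N]sl -(size_positive_word l) -(size_map fst) index_mem.
  by apply: mem_unzip1_full; rewrite ?size_positive_word // positive_word_uniq.
case: i => n; elim: n => [|n IH] nd.
  have -> : Ordinal nd = i0 by apply: val_inj.
  by rewrite addn0 modn_small.
have nd' : (n < d)%N by lia.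
have [IH1 IH2] := IH nd'; have := forallP cl (Ordinal nd').
move=> /forallP/(_ (Ordinal nd)); rewrite /= eqxx /= => /andP[_].
rewrite (compatible_sign (Ordinal nd') cl) -/(positive_word l) /adjacent.
move: (idx (Ordinal nd)) (idx i0) IH1 IH2 => /=.
set p := index (Ordinal nd) _; set p' := index (Ordinal nd') _; set p0 := index i0 _.
move=> pd p0d IH1 IH2 /orP[/eqP ep|/and3P[ns /eqP ep /eqP ep']].
  split=> [|st]; last by rewrite ep IH2 // addnS.
  by rewrite ep addnS -[(p0 + n).+1]addn1 -modnDml -IH1 addn1 -ep modn_small.
split=> [|st]; last by rewrite st in ns.
by rewrite ep addnS -[(p0 + n).+1]addn1 -modnDml -IH1 ep' addn1 prednK // modnn.
Qed.

Lemma positive_word_inj l l' : uniq (unzip1 l) -> uniq (unzip1 l') ->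
  size l = d -> size l' = d ->
  (forall i, (i, true) \in l) -> (forall i, (i, true) \in l') ->
  (forall i, index i (unzip1 l) = index i (unzip1 l')) -> l = l'.
Proof.
have pos l1 : uniq (unzip1 l1) -> (forall i, (i, true) \in l1) ->
    l1 = [seq (i, true) | i <- unzip1 l1].
  move=> u1 p1; rewrite /unzip1 -map_comp -[LHS]map_id; apply/eq_in_map => -[i b] ib /=.
  by rewrite (mem_signed_inj u1 ib (p1 i)).
move=> ul ul' sl sl' pl pl' idx; rewrite (pos l) // (pos l') //; congr map.
have s1 : size (unzip1 l) = size (unzip1 l') by rewrite !size_map sl sl'.
apply: (@eq_from_nth _ i0) => // n ns.
by rewrite -{2}(index_uniq i0 ns ul) idx nth_index // mem_unzip1_full.
Qed.

(** A compatible arrangement is determined by its common exponent and the position of index 0. The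
    exponent is free only if [x] is an involution, because a word and its inverse have inverse
    values. *)
Lemma card_arrangements strict a x :
  (forall l : d.-tuple ('I_d * bool), l \in arrangements a x -> compatible strict l) ->
  #|arrangements a x| <=
  ((if (x * x == 1)%g then 2 else 1) * (if strict then 1 else d))%N.
Proof.
move=> cA; pose P (l : d.-tuple ('I_d * bool)) := index i0 (unzip1 (positive_word l)).
have A_uniq (l : d.-tuple ('I_d * bool)) : l \in arrangements a x -> uniq (unzip1 l).
  by rewrite inE => /andP[].
have PK (l l' : d.-tuple ('I_d * bool)) :
    l \in arrangements a x -> l' \in arrangements a x ->
    P l = P l' -> positive_word l = positive_word l'.
  move=> lA lA' ePl; have ul := A_uniq _ lA; have ul' := A_uniq _ lA'.
  have [sl sl'] := (size_tuple l, size_tuple l').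
  apply: positive_word_inj; rewrite ?positive_word_uniq ?size_positive_word //.
  - exact: compatible_positive (cA _ lA).
  - exact: compatible_positive (cA _ lA').
  move=> i; have [-> _] := compatible_index i ul sl (cA _ lA).
  have [-> _] := compatible_index i ul' sl' (cA _ lA').
  by rewrite -/(P l) -/(P l') ePl.
have Pd (l : d.-tuple ('I_d * bool)) : l \in arrangements a x -> (P l < d)%N.
  move=> lA; rewrite /P -[X in (_ < X)%N](size_tuple l) -(size_positive_word l).
  rewrite -(size_map fst) index_mem.
  by apply: mem_unzip1_full; rewrite ?size_positive_word ?size_tuple // positive_word_uniq ?A_uniq.
(* Without wrap-around the last index sits at position [P l + (d - 1)], which is less than [d]. *)
have P0 (l : d.-tuple ('I_d * bool)) : l \in arrangements a x -> strict -> P l = 0%N.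
  move=> lA st.
  have dl : (d.-1 < d)%N by lia.
  have [_ /(_ st)] := compatible_index (Ordinal dl) (A_uniq _ lA) (size_tuple l) (cA _ lA).
  have : (index (Ordinal dl) (unzip1 (positive_word l)) < d)%N.
    rewrite -[X in (_ < X)%N](size_tuple l) -(size_positive_word l) -(size_map fst) index_mem.
    by apply: mem_unzip1_full; rewrite ?size_positive_word ?size_tuple // positive_word_uniq ?A_uniq.
  by rewrite -/(P l) /=; lia.
(* The first component is constantly [false] unless [x * x = 1], so that the image has the claimed
   size. *)
pose f (l : d.-tuple ('I_d * bool)) := ((x * x == 1) && ((i0, true) \in l), insubd i0 (P l)).
have f_inj : {in arrangements a x &, injective f}.
  move=> l l' lA lA' [es /(congr1 val)]; rewrite !val_insubd !Pd // => /(PK _ _ lA lA') ePl.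
  apply: val_inj; move: ePl; rewrite /positive_word.
  have el : eval a l = x by move: lA; rewrite inE => /andP[_ /eqP].
  have el' : eval a l' = x by move: lA'; rewrite inE => /andP[_ /eqP].
  case: (boolP ((i0, true) \in l)) es => sl; case: (boolP ((i0, true) \in l')) => sl' //=.
  - rewrite andbF andbT => xx e; suff: x * x == 1 by rewrite xx.
    have xV : x = x^-1 by rewrite -[LHS]el e eval_inv_word el'.
    by rewrite {1}xV mulVg.
  - rewrite andbF andbT => xx e; suff: x * x == 1 by rewrite -xx.
    have xV : x = x^-1 by rewrite -[LHS]el' -e eval_inv_word el.
    by rewrite {1}xV mulVg.
  by move=> _ /(congr1 (@inv_word d)); rewrite !inv_wordK.
rewrite -(card_in_imset f_inj).
apply: leq_trans (_ : #|setX (if x * x == 1 then setT else [set false])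
  (if strict then [set i0] else setT)| <= _); last first.
  by rewrite cardsX; do 2 case: ifP => _; rewrite ?cardsT ?cards1 ?card_bool ?card_ord.
apply: subset_leq_card; apply/subsetP => _ /imsetP[l lA ->]; rewrite inE /=.
apply/andP; split; first by case: ifP; rewrite !inE.
case: (boolP strict) => st; last by rewrite inE.
by rewrite inE -val_eqE val_insubd Pd //= P0.
Qed.
End Multiplicity.
End Compatible.

(** * Admissible factorizations and their supports *)

Section Admissible.
Variables (gT : finGroupType) (d : nat).
Implicit Types (x y z v : gT) (a : {ffun 'I_d -> gT}) (l : seq ('I_d * bool)).
Implicit Types (w : {ffun 'I_d -> gT} * {ffun 'I_d -> bool}).

Definition distinct_upto_inverse a :=
  [forall i : 'I_d, forall k : 'I_d, forall b : bool,
    (i != k) ==> (a i != sgn b (a k))].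

Definition admissible strict x : {set {ffun 'I_d -> gT}} :=
  [set a in factorizations d x | distinct_upto_inverse a &&
    [forall l : d.-tuple ('I_d * bool), (l \in arrangements a x) ==> compatible strict l]].

Definition word_support w := [set sgn (w.2 i) (w.1 i) | i : 'I_d].

(** Every choice of exponents is allowed, since the graph is undirected; these [2 ^ d] choices
    account for the factor [2 ^ d] in the threshold for [p]. *)
Definition supports strict x : {set {set gT}} :=
  [set word_support w | w in setX (admissible strict x) setT].

Lemma sgn_eq_distinct a (e : {ffun 'I_d -> bool}) i k : distinct_upto_inverse a ->
  sgn (e i) (a i) = sgn (e k) (a k) -> i = k.
Proof.
move=> /forallP/(_ i)/forallP/(_ k)/forallP/(_ (e i == e k)) aik eik.
apply/eqP; apply: contraTT aik => ->; rewrite negbK /= -sgn_sgn -eik sgn_sgn eqxx.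
by [].
Qed.

Lemma card_support w : distinct_upto_inverse w.1 -> #|word_support w| = d.
Proof.
by move=> aw; rewrite card_imset ?card_ord // => i k; exact: sgn_eq_distinct.
Qed.

(** If [(a, e)] has the same support as [(a0, e0)], each [a i] is an entry of [a0] or its inverse,
    so [a] spells an arrangement of [a0] with value [x]. The pair can be recovered from the
    arrangement, so each fibre of [word_support] is bounded by [card_arrangements]. *)
Lemma card_supports strict x : (0 < d)%N ->
  (#|admissible strict x| * 2 ^ d <=
   (if (x * x == 1)%g then 2 else 1) * (if strict then 1 else d) * #|supports strict x|)%N.
Proof.
move=> d0; set m := (X in (_ <= X * _)%N).
have -> : (#|admissible strict x| * 2 ^ d)%N =
    #|setX (admissible strict x) [set: {ffun 'I_d -> bool}]|.
  by rewrite cardsX cardsT card_ffun card_ord card_bool.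
rewrite -sum1_card (partition_big_imset word_support) /= mulnC -sum_nat_const.
apply: leq_sum => A /imsetP[[a0 e0]]; rewrite inE => /andP[/= a0adm _] ->.
rewrite sum1dep_card.
move: (a0adm); rewrite inE => /and3P[a0x a0dist /forallP a0comp].
apply: leq_trans (_ : #|arrangements a0 x| <= _); last first.
  apply: (card_arrangements d0) => l lA.
  by have := a0comp l; rewrite lA.
pose i0 : 'I_d := Ordinal d0.
(* The default [i0] is never reached for [w] in the fibre [F]. The sign [g w i] is chosen so that
   [w.1 i] is [a0 (p w i)] with exponent [g w i]. *)
pose p w i := odflt i0 [pick k | sgn (e0 k) (a0 k) == sgn (w.2 i) (w.1 i)].
pose g w i := w.2 i == e0 (p w i).
pose phi w : d.-tuple ('I_d * bool) := [tuple (p w i, g w i) | i < d].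
set F := [set w | _].
have pE w i : w \in F -> sgn (e0 (p w i)) (a0 (p w i)) = sgn (w.2 i) (w.1 i).
  rewrite inE => /andP[_ /eqP eA].
  have : sgn (w.2 i) (w.1 i) \in word_support w by apply/imsetP; exists i.
  rewrite eA => /imsetP[k _ /= ek]; rewrite /p; case: pickP => [k' /eqP //|/(_ k)].
  by rewrite ek eqxx.
have aE w i : w \in F -> w.1 i = sgn (g w i) (a0 (p w i)).
  by move=> wF; rewrite /g -sgn_sgn pE // sgn_sgn eqxx.
have phi_inj : {in F &, injective phi}.
  move=> w w' wF wF' /(congr1 val) /= ephi.
  have epg i : (p w i, g w i) = (p w' i, g w' i).
    have /eq_in_map := ephi; apply; exact: mem_enum.
  have ea : w.1 = w'.1.
    by apply/ffunP => i; rewrite !aE //; have [-> ->] := epg i.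
  have ee : w.2 = w'.2.
    apply/ffunP => i; have [ep] := epg i; rewrite /g ep.
    by case: (w.2 i) (w'.2 i) (e0 _) => [] [] [].
  by move: w w' ea ee {wF wF' ephi epg} => [? ?] [? ?] /= -> ->.
rewrite -(card_in_imset phi_inj); apply: subset_leq_card.
apply/subsetP => _ /imsetP[w wF ->]; rewrite inE.
have wadm : w.1 \in admissible strict x.
  by move: wF; rewrite inE => /andP[]; case: (w) => ? ? /setXP[].
move: wadm; rewrite inE => /and3P[wx wdist _].
apply/andP; split.
  rewrite /unzip1 /= -map_comp map_inj_uniq ?enum_uniq // => i k /= epik.
  by apply: (sgn_eq_distinct wdist (e := w.2)); rewrite -!pE // epik.
move: wx; rewrite inE /eval /id_word /= !big_map => /eqP <-.
by apply/eqP; apply: eq_bigr => i _ /=; rewrite -aE.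
Qed.
End Admissible.

(** * Almost all factorizations are admissible *)

Section CountAdmissible.
Variables (gT : finGroupType) (d D : nat).
Implicit Types (x y z v : gT) (a : {ffun 'I_d -> gT}) (l : seq ('I_d * bool)).
Hypothesis roots_le : forall c : gT, #|[set y : gT | y * y == c]| <= D.
Hypothesis centralizers_le : (\sum_(v : gT) #|'C[v]| <= D * #|gT|)%N.
Hypothesis d_ge2 : (2 <= d)%N.

(** A consecutive pair [i], [j] witnesses the failure. If [i] has exponent -1, the word and its
    value are inverted first; [x] and its inverse have the same centralizer. *)
Lemma count_incompatible (strict : bool) x (l : d.-tuple ('I_d * bool)) : uniq (unzip1 l) ->
  (strict -> #|'C[x]| <= D) -> ~~ compatible strict l ->
  (#|gT| * #|[set a in factorizations d x | eval a l == x]| <=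
   D * #|factorizations d x|)%N.
Proof.
move=> ul CD; rewrite negb_forall => /existsP[i]; rewrite negb_forall => /existsP[j].
rewrite negb_imply => /andP[/eqP ij].
have sl : size l = d by rewrite size_tuple.
have := mem_signed i ul sl; have := mem_signed j ul sl.
case: (boolP ((i, true) \in l)) => il jl il'.
  by move=> nadj; apply: (count_nonadjacent roots_le centralizers_le x ij ul sl il jl CD nadj).
move=> nadj.
have -> : [set a in factorizations d x | eval a l == x] =
    [set a in factorizations d x | eval a (inv_word l) == x^-1].
  by apply/setP => a; rewrite !inE eval_inv_word (inj_eq invg_inj).
apply: (@count_nonadjacent _ _ _ roots_le centralizers_le i j x x^-1 ij strict _
  (~~ ((j, true) \in l))) => //.
- by rewrite unzip1_inv_word rev_uniq.
- by rewrite size_rev size_map.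
- by rewrite mem_inv_word.
- by rewrite mem_inv_word negbK.
move=> st; rewrite (_ : 'C[x^-1] = 'C[x]) ?CD //.
by apply/setP => y; apply/cent1P/cent1P => [/commuteV|/commuteV]; rewrite ?invgK.
Qed.

(** A third index absorbs the product condition, leaving [a i] and [a k] independent. If there is
    none, then [d = 2] and [x] is the product of the two entries: equal entries give a square root
    of [x], and inverse entries give [x = 1]. *)
Lemma count_coincidence x (i k : 'I_d) b : x != 1 -> i != k ->
  (#|gT| * #|[set a in factorizations d x | a i == sgn b (a k)]| <=
   D * #|factorizations d x|)%N.
Proof.
move=> x1 ik.
have N0 := finGroup_card_gt0 gT.
have D0 : (0 < D)%N.
  apply: leq_trans (roots_le 1); apply/card_gt0P; exists 1.
  by rewrite inE mulg1.
have [/existsP[m /andP[mi mk]]|] := boolP [exists m : 'I_d, (m != i) && (m != k)].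
  apply: (@leq_trans #|factorizations d x|); last by rewrite leq_pmull.
  rewrite -sum_nat_pred (@sum_factorizations gT d m x (fun a => a i == sgn b (a k))); last first.
    by move=> z a; rewrite !ffunE ![_ == m]eq_sym (negbTE mi) (negbTE mk).
  rewrite sum_nat_pred1 -(leq_pmul2l N0) (card_factorizations m).
  have := @count_shift gT {ffun 'I_d -> gT} setT (@shift1 gT d i)
    (fun a => a i == sgn b (a k)) 1 (@shift1_inj gT d i).
  rewrite mul1n cardsT card_ffun card_ord.
  have -> : [set a in [set: {ffun 'I_d -> gT}] | a i == sgn b (a k)] =
      [set a : {ffun 'I_d -> gT} | a i == sgn b (a k)].
    by apply/setP => a; rewrite !inE.
  apply=> [z a|a _]; first by rewrite !inE.
  apply: leq_trans (card_le1_inj (sgn b (a k)) (mulgI (a i))).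
  apply: subset_leq_card; apply/subsetP => z.
  by rewrite !inE !ffunE eqxx eq_sym (eq_sym k) (negbTE ik) eq_sym.
rewrite negb_exists => /forallP no3.
have d0 : (0 < d)%N by lia.
have d1 : (1 < d)%N by lia.
pose i0 : 'I_d := Ordinal d0; pose i1 : 'I_d := Ordinal d1.
have ed : d = 2.
  apply/eqP; rewrite eqn_leq d_ge2 andbT -[X in (X <= _)%N]card_ord.
  have -> : #|'I_d| = #|[set i; k]|.
    rewrite -cardsT; congr #|pred_of_set _|; apply/setP => m.
    by rewrite !inE; have := no3 m; rewrite negb_and !negbK.
  by rewrite cards2; case: (_ != _).
have evE a : eval a (id_word d) = a i0 * a i1.
  have ew : id_word d = [:: (i0, true); (i1, true)].
    have es : enum 'I_d = [:: i0; i1].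
      apply: (inj_map val_inj); rewrite val_enum_ord.
      by rewrite {1}ed.
    by rewrite /id_word es.
  by rewrite ew !evalE.
have cases : (i = i0 /\ k = i1) \/ (i = i1 /\ k = i0).
  move: ik (ltn_ord i) (ltn_ord k); rewrite -val_eqE /= => ik il kl.
  have [ei|ei] : (val i = 0 \/ val i = 1)%N by move: ed => /=; lia.
    by left; split; apply: val_inj; move: ed ei ik => /=; lia.
  by right; split; apply: val_inj; move: ed ei ik => /=; lia.
have EN : #|factorizations d x| = #|gT|.
  apply/eqP; rewrite -(eqn_pmul2l N0) (card_factorizations i0).
  by rewrite {1}ed expnS expn1.
rewrite EN mulnC leq_pmul2r //.
case: b; last first.
  rewrite (_ : [set a in _ | _] = set0) ?cards0 //.
  apply/setP => a; rewrite !inE evE; apply/negbTE; apply: contra x1.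
  case/andP=> /eqP <- /eqP aik.
  by case: cases aik => -[-> ->] /= ->; rewrite ?mulVg ?mulgV.
apply: leq_trans (roots_le x).
rewrite -(card_in_imset (f := fun a : {ffun 'I_d -> gT} => a i0)).
  apply: subset_leq_card; apply/subsetP => _ /imsetP[a + ->].
  rewrite !inE evE => /andP[/eqP <- /eqP /=].
  by case: cases => -[-> ->] ->.
move=> a a'; rewrite !inE !evE => /andP[_ /eqP h] /andP[_ /eqP h'] e0.
have h1 : a i1 = a i0 by case: cases h => -[-> ->] /= ->.
have h1' : a' i1 = a' i0 by case: cases h' => -[-> ->] /= ->.
apply/ffunP => m.
by have := no3 m; rewrite negb_and !negbK => /orP[]/eqP ->; case: cases => -[ei ek]; rewrite ?ei ?ek
  ?h1 ?h1'.
Qed.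

(** Union bound over at most [(2 d) ^ d] incompatible words and [2 d ^ 2] coincidences, each of
    which affects a proportion of at most [D / #|gT|] of the factorizations. *)
Lemma card_admissible (strict : bool) x : x != 1 -> (strict -> #|'C[x]| <= D) ->
  (#|gT| * #|factorizations d x| <= #|gT| * #|admissible d strict x| +
    ((d * 2) ^ d + d * d * 2) * (D * #|factorizations d x|))%N.
Proof.
move=> x1 CD; set E := factorizations d x; set G := admissible d strict x.
have N0 := finGroup_card_gt0 gT.
pose K := (D * #|E| %/ #|gT|)%N.
have leK n : (#|gT| * n <= D * #|E|)%N -> (n <= K)%N.
  by move=> h; rewrite leq_divRL // mulnC.
pose B1 (l : d.-tuple ('I_d * bool)) :=
  if uniq (unzip1 l) && ~~ compatible strict l then [set a in E | eval a l == x] else set0.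
pose B2 (q : 'I_d * 'I_d * bool) :=
  if q.1.1 != q.1.2 then [set a in E | a q.1.1 == sgn q.2 (a q.1.2)] else set0.
pose B (t : (d.-tuple ('I_d * bool)) + ('I_d * 'I_d * bool)) :=
  match t with inl l => B1 l | inr q => B2 q end.
have BK t : #|B t| <= K.
  apply: leK; case: t => [l|[[i k] b]] /=.
    rewrite /B1; case: ifP; last by rewrite cards0 muln0.
    by case/andP=> ul nc; exact: (count_incompatible ul CD nc).
  by rewrite /B2 /=; case: ifP; rewrite ?cards0 ?muln0 // => ik; exact: count_coincidence.
have cov : #|E :\: G| <= (#|{: d.-tuple ('I_d * bool) + 'I_d * 'I_d * bool}| * K)%N.
  apply: (card_cover_le _ BK) => a; rewrite in_setD => /andP[nG aE].
  move: nG; rewrite inE aE /= negb_and => /orP[].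
    rewrite negb_forall => /existsP[i]; rewrite negb_forall => /existsP[k].
    rewrite negb_forall => /existsP[b]; rewrite negb_imply negbK => /andP[ik aik].
    by exists (inr ((i, k), b)); rewrite /= /B2 /= ik in_set aE.
  rewrite negb_forall => /existsP[l]; rewrite negb_imply inE -andbA => /and3P[ul al nc].
  by exists (inl l); rewrite /= /B1 ul nc /= in_set aE.
have sub : G \subset E by apply/subsetP => a; rewrite inE => /andP[].
have := cardsID G E; rewrite (setIidPr sub) => eE; rewrite -{1}eE.
rewrite mulnDr leq_add2l.
apply: leq_trans (_ : #|gT| * (((d * 2) ^ d + d * d * 2) * K) <= _)%N.
  rewrite leq_mul2l; apply/orP; right; apply: leq_trans cov _.
  by rewrite card_sum card_tuple !card_prod card_bool card_ord.
rewrite mulnCA leq_mul2l; apply/orP; right.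
by rewrite [leqLHS]mulnC; exact: leq_trunc_div.
Qed.
End CountAdmissible.

Local Open Scope ring_scope.

(** * The overlap term in Janson's inequality *)

Section Overlaps.
Variables (gT : finGroupType) (d : nat).
Implicit Types (a : {ffun 'I_d -> gT}) (e : {ffun 'I_d -> bool}) (I : {set 'I_d}).

Lemma card_preim_sgn b (A : {set gT}) : #|[set y | sgn b y \in A]| = #|A|.
Proof.
rewrite -(card_imset _ (@sgn_inj gT b)); apply: eq_card => y.
apply/imsetP/idP => [[z + ->]|yA]; first by rewrite inE.
by exists (sgn b y); rewrite ?inE sgn_sgn eqxx.
Qed.

(** The coordinate [m] is unconstrained, so the product condition divides the count by [#|gT|]. *)
Lemma count_prescribed x e I (m : 'I_d) (A : {set gT}) : m \notin I ->
  (#|gT| * #|[set a in factorizations d x | [forall i in I, sgn (e i) (a i) \in A]]| <=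
   #|A| ^ #|I| * #|gT| ^ (d - #|I|))%N.
Proof.
move=> mI.
pose F := [set a : {ffun 'I_d -> gT} | [forall i in I, sgn (e i) (a i) \in A]].
have cF : #|F| = (#|A| ^ #|I| * #|gT| ^ (d - #|I|))%N.
  pose P i := if i \in I then mem [set y | sgn (e i) y \in A] else mem [set: gT].
  have -> : #|F| = #|family P|.
    apply: eq_card => a; rewrite inE; apply/forall_inP/familyP => h i.
      by rewrite /P; case: ifP => [/h|_]; rewrite inE.
    by move=> iI; have := h i; rewrite /P iI inE.
  rewrite card_family foldrE big_image /= (bigID (mem I)) /=.
  rewrite (eq_bigr (fun=> #|A|)); last first.
    by move=> i iI; rewrite /P iI; exact: card_preim_sgn.
  rewrite [X in (_ * X)%N](eq_bigr (fun=> #|gT|)); last first.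
    by move=> i /negbTE iI; rewrite /P iI; exact: cardsT.
  rewrite !prod_nat_const; congr (_ * _ ^ _)%N.
  by rewrite -[X in (X - _)%N]card_ord -(cardC (mem I)) addKn; apply: eq_card.
have -> : [set a in factorizations d x | [forall i in I, sgn (e i) (a i) \in A]] =
    [set a in F | eval a (id_word d) == x] by apply/setP => a; rewrite !inE andbC.
rewrite -cF -[leqRHS]mul1n.
apply: (count_shift (@shift1_inj gT d m)) => [z a|a _]; last first.
  by rewrite eval_id_shift1_card.
rewrite !inE; apply: eq_forallb_in => i iI; rewrite ffunE; case: eqP => // im.
by rewrite im (negbTE mI) in iI.
Qed.

Lemma sum_imset_le (R : realType) (U V : finType) (f : U -> V) (W : {set U})
    (P : pred V) (F : V -> R) : (forall v, 0 <= F v) ->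
  \sum_(v in f @: W | P v) F v <= \sum_(u in W | P (f u)) F (f u).
Proof.
move=> F0.
have -> : \sum_(u in W | P (f u)) F (f u) = \sum_(u in W) (if P (f u) then F (f u) else 0).
  by rewrite big_mkcondr.
rewrite (partition_big_imset f) /= big_mkcondr /=; apply: ler_sum => v /imsetP[u uW ->].
rewrite (bigD1 u) ?uW ?eqxx //=; rewrite lerDl; apply: sumr_ge0 => u' _.
by case: ifP.
Qed.

(** Sorted by the set [J] of indices whose letters lie in [A]. It is nonempty because the supports
    meet, and proper because two distinct sets of size [d] cannot contain each other. With
    [k = #|J|], there are at most [2^d d^k N^(d-k) / N] signed tuples of weight [p^(d-k)];
    [1 <= k <= d] and [N p >= 1] give a bound uniform in [J], and there are [2^d] sets [J]. *)
Lemma sum_overlaps (R : realType) (p : R) strict x (A : {set gT}) :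
  0 <= p <= 1 -> 1 <= #|gT|%:R * p -> #|A| = d -> (0 < d)%N ->
  \sum_(B in supports d strict x | (B != A) && ~~ [disjoint A & B]) p ^+ #|B :\: A| <=
  (4 * d%:R) ^+ d * (#|gT|%:R * p) ^+ d.-1 / #|gT|%:R.
Proof.
move=> p01 Np1 cA d0; have [p0 p1] := andP p01.
have N0 : 0 < #|gT|%:R :> R by rewrite ltr0n finGroup_card_gt0.
set bound := (X in _ <= X).
apply: le_trans (sum_imset_le _ _ _ _) _; first by move=> B; exact: exprn_ge0.
pose I (w : {ffun 'I_d -> gT} * {ffun 'I_d -> bool}) := [set i | sgn (w.2 i) (w.1 i) \in A].
pose Q (w : {ffun 'I_d -> gT} * {ffun 'I_d -> bool}) :=
  (w \in setX (admissible d strict x) setT) &&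
  ((word_support w != A) && ~~ [disjoint A & word_support w]).
have Idist w : Q w -> [/\ w.1 \in factorizations d x, #|word_support w :\: A| = (d - #|I w|)%N,
    I w != set0 & I w != setT].
  case/andP=> wadm /andP[wA meet].
  have {}wadm : w.1 \in admissible d strict x by move: wadm; case: (w) => ? ? /setXP[].
  move: wadm; rewrite inE => /and3P[wE wdist _].
  have sinj : injective (fun i => sgn (w.2 i) (w.1 i)).
    by move=> i k; exact: sgn_eq_distinct.
  have IT : I w != setT.
    apply: contraNneq wA => IwT; rewrite eqEcard cA card_support // leqnn andbT.
    by apply/subsetP => _ /imsetP[i _ ->]; have := in_setT i; rewrite -IwT inE.
  split=> //; last first.
    apply: contraNneq meet => Iw0; rewrite disjoint_sym; apply/pred0P => y /=.
    apply/negP => /andP[/imsetP[i _ ->] yA].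
    by have := in_set0 i; rewrite -Iw0 inE yA.
  rewrite (_ : d - #|I w| = #|~: I w|)%N; last first.
    by have := cardsC (I w); rewrite card_ord => /esym {1}->; rewrite addKn.
  rewrite -(card_imset _ sinj); apply: eq_card => y.
  rewrite in_setD; apply/andP/imsetP => [[yA /imsetP[i _ ey]]|[i + ->]].
    by exists i => //; rewrite !inE -ey.
  by rewrite !inE => iA; split=> //; apply/imsetP; exists i.
rewrite (eq_bigl Q) //.
rewrite (eq_bigr (fun w => p ^+ (d - #|I w|))); last by move=> w /Idist[_ -> _ _].
rewrite (partition_big I (fun J => (J != set0) && (J != setT))) /=; last first.
  by move=> w /Idist[_ _ -> ->].
apply: (@le_trans _ _ (\sum_(J : {set 'I_d}) (2 * d%:R) ^+ d * (#|gT|%:R * p) ^+ d.-1 / #|gT|%:R)).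
  rewrite big_mkcond; apply: ler_sum => J _.
  case: ifP => [/andP[J0 JT]|_]; last first.
    by rewrite !mulr_ge0 ?invr_ge0 ?exprn_ge0 ?mulr_ge0 ?ler0n.
  have [m mJ] : exists m, m \notin J.
    apply/existsP; rewrite -negb_forall; apply: contra JT => /forallP h.
    by apply/eqP/setP => m; rewrite inE h.
  rewrite (eq_bigr (fun=> p ^+ (d - #|J|))); last by move=> w /andP[_ /eqP ->].
  rewrite sumr_const.
  set c := (X in _ *+ X).
  have cle : (#|gT| * c <= 2 ^ d * (d ^ #|J| * #|gT| ^ (d - #|J|)))%N.
    pose X e := [set a in factorizations d x | [forall i in J, sgn (e i) (a i) \in A]].
    have : (c <= \sum_(e : {ffun 'I_d -> bool}) #|X e|)%N.
      rewrite /c -sum1_card.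
      rewrite (partition_big (fun w : {ffun 'I_d -> gT} * {ffun 'I_d -> bool} => w.2) xpredT) //=.
      apply: leq_sum => e _; rewrite sum1_card.
      rewrite -(card_in_image (f := fst)); last first.
        move=> [a1 e1] [a2 e2]; rewrite !unfold_in /= => /andP[_ /eqP ->] /andP[_ /eqP ->] -> //.
      apply: subset_leq_card; apply/subsetP => _ /imageP[[a e1] h ->].
      rewrite unfold_in /= in h; case/andP: h => /andP[/Idist[aE _ _ _] /eqP IJ] /eqP <-.
      by rewrite in_set aE; apply/forall_inP => i; rewrite -IJ inE.
    rewrite -(leq_pmul2l (finGroup_card_gt0 gT)) => /leq_trans; apply.
    rewrite big_distrr /=.
    rewrite (_ : 2 ^ d = #|{: {ffun 'I_d -> bool}}|)%N; last by rewrite card_ffun card_bool card_ord.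
    rewrite -sum_nat_const; apply: leq_sum => e _.
    by have := count_prescribed x e A mJ; rewrite cA.
  have k1 : (0 < #|J|)%N by rewrite card_gt0.
  have kd : (#|J| <= d)%N by rewrite -[X in (_ <= X)%N]card_ord max_card.
  rewrite ler_pdivlMr //.
  have -> : p ^+ (d - #|J|) *+ c * #|gT|%:R = p ^+ (d - #|J|) * (#|gT| * c)%:R.
    by rewrite -[_ *+ c]mulr_natr natrM -mulrA [c%:R * _]mulrC.
  apply: le_trans (_ : p ^+ (d - #|J|) * (2 ^ d * (d ^ #|J| * #|gT| ^ (d - #|J|)))%:R <= _).
    by rewrite ler_wpM2l ?exprn_ge0 // ler_nat.
  have -> : p ^+ (d - #|J|) * (2 ^ d * (d ^ #|J| * #|gT| ^ (d - #|J|)))%:R =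
      2 ^+ d * (d%:R ^+ #|J| * (#|gT|%:R * p) ^+ (d - #|J|)).
    by rewrite !natrM !natrX exprMn; set u := _ ^+ (d - _); set v := _ ^+ (d - _);
       set u1 := 2 ^+ d; set u2 := _ ^+ #|J|; ring.
  rewrite [(2 * d%:R) ^+ d]exprMn -mulrA ler_wpM2l ?exprn_ge0 ?ler0n //.
  apply: ler_pM; rewrite ?exprn_ge0 ?ler0n ?(le_trans ler01 Np1) //.
    by apply: ler_weXn2l => //; rewrite ler1n.
  by apply: ler_weXn2l => //; lia.
rewrite sumr_const (_ : #|_| = 2 ^ d)%N; last first.
  have := card_powerset [set: 'I_d]; rewrite cardsT card_ord => <-.
  by apply: eq_card => J; rewrite powersetE subsetT.
rewrite /bound -[_ *+ (2 ^ d)]mulr_natr natrX !exprMn.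
have -> : 4 ^+ d = 2 ^+ d * 2 ^+ d :> R by rewrite -exprMn; congr (_ ^+ _); ring.
set u := 2 ^+ d; set v := d%:R ^+ d; set w := _ ^+ d.-1; set w' := _ ^+ d.-1.
by rewrite le_eqVlt; apply/orP; left; apply/eqP; ring.
Qed.
End Overlaps.

(** * From supports to the diameter *)

Section Diameter.
Variables (gT : finGroupType).

Lemma dist_le_prod (S : {set gT}) (s : seq gT) g :
  all (fun y => (y \in S) || (y^-1%g \in S)) s ->
  dist_le S (size s) g (g * \prod_(y <- s) y)%g.
Proof.
elim: s g => [|y s IH] g /=; first by move=> _; exists [::]; rewrite big_nil mulg1.
case/andP=> yS /(IH (g * y)%g)[t [st pt lt]]; rewrite big_cons mulgA.
(* A trivial letter would be a loop, so the walk skips it; hence the distance is only bounded by the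
   length of [s]. *)
have [y1|y1] := eqVneq y 1%g.
  by exists t; split; rewrite ?(leq_trans st) //; move: pt lt; rewrite y1 mulg1.
exists ((g * y)%g :: t); split=> //=; rewrite pt andbT /cay_adj.
rewrite mulKg invMg mulgKV yS andbT.
by rewrite -{1}(mulg1 g) (inj_eq (mulgI g)) eq_sym.
Qed.

Lemma diam_le_supports (S : {set gT}) d (strict : gT -> bool) :
  (forall x, x != 1%g -> exists2 A, A \in supports d (strict x) x & A \subset S) ->
  diam_le S d.
Proof.
move=> cov g h; have [->|gh] := eqVneq g h; first by exists [::].
have [|A] := cov (g^-1 * h)%g; first by rewrite -eq_mulVg1.
case/imsetP=> -[a e] /setXP[]; rewrite inE => /andP[+ _] _ ->.
rewrite inE => /eqP ax sS.
pose s := [seq a i | i <- enum 'I_d].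
have := @dist_le_prod S s g; rewrite {1}/s size_map size_enum_ord.
have -> : (\prod_(y <- s) y)%g = (g^-1 * h)%g.
  by rewrite -ax /eval /id_word !big_map.
rewrite mulKVg; apply; apply/allP => _ /mapP[i _ ->].
have ai : sgn (e i) (a i) \in word_support (a, e) by apply/imsetP; exists i.
have := subsetP sS _ ai.
by rewrite /=; case: (e i) => /= ->; rewrite ?orbT.
Qed.

Lemma prob_diam_gtE (R : realType) (p : R) d :
  prob_diam_gt gT p d =
  expect (fun=> p) (fun S : {set gT} => (~~ `[< diam_le S d >])%:R).
Proof.
rewrite /prob_diam_gt /expect big_mkcond; apply: eq_bigr => S _.
by rewrite set_weight_const; case: ifP; rewrite ?mulr1 ?mulr0.
Qed.

Lemma diam_le_subset (S S' : {set gT}) d : S \subset S' -> diam_le S d -> diam_le S' d.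
Proof.
move=> /subsetP sub diamS g h; have [s [ss ps ls]] := diamS g h; exists s; split=> //.
apply: sub_path ps => x y /andP[xy /orP[]/sub xS]; rewrite /cay_adj xy xS ?orbT //.
Qed.

Lemma prob_diam_gt_antitone (R : realType) (p p' : R) d : 0 <= p <= p' -> p' <= 1 ->
  prob_diam_gt gT p' d <= prob_diam_gt gT p d.
Proof.
move=> pp' p1; rewrite !prob_diam_gtE; apply: expect_antitone => // S S' sub.
rewrite ler_nat; apply: leq_bool; apply: contra => /asboolP h.
by apply/asboolP; exact: diam_le_subset h.
Qed.

(** By translation, the distance from [g] to [h] depends only on [g^-1 * h], so a union bound over
    single elements suffices. The choice of [strict] may depend on the element. *)
Lemma prob_diam_gt_le (R : realType) (p : R) d (strict : gT -> bool) : 0 <= p <= 1 ->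
  prob_diam_gt gT p d <= \sum_(x : gT | x != 1%g)
    expect (fun=> p) (avoids R (enum (supports d (strict x) x))).
Proof.
move=> p01; rewrite -expect_sum prob_diam_gtE.
apply: ler_expect => // S.
case: (boolP [forall x : gT, (x != 1%g) ==>
    has (fun A : {set gT} => A \subset S) (enum (supports d (strict x) x))]) => [/forallP h|].
  have -> : `[< diam_le S d >].
    apply/asboolP; apply: (@diam_le_supports S d strict) => x x1.
    have := h x; rewrite x1 => /hasP[A]; rewrite mem_enum => Ax AS; by exists A.
  by apply: sumr_ge0 => x _; rewrite /avoids.
rewrite negb_forall => /existsP[x]; rewrite negb_imply => /andP[x1 hx].
rewrite (bigD1 x) //= {1}/avoids hx.
apply: le_trans (_ : 1 <= _); first by case: (~~ _).
by rewrite lerDl; apply: sumr_ge0 => y _; rewrite /avoids.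
Qed.
End Diameter.

(** * Centralizers and square roots *)

Section Centralizers.
Variables (R : realType) (gT : finGroupType).

Lemma cl_mul_centralizer (u : gT) : (#|'C[u]%g| * cl u = #|gT|)%N.
Proof.
have := Lagrange (subsetIl [set: gT]%G 'C[u]%G).
by rewrite /= index_cent1 setTI cardsT.
Qed.

Lemma centralizer_le (M : R) (u : gT) : 0 < M -> u \notin small_class gT M ->
  #|'C[u]%g|%:R <= #|gT|%:R / M.
Proof.
rewrite inE -ltNge => M0 Mcl; rewrite ler_pdivlMr // -(cl_mul_centralizer u) natrM.
by rewrite ler_wpM2l // ltW.
Qed.

(** Elements with small classes get the trivial bound [#|gT|], all others [#|gT| / M]. *)
Lemma sum_centralizers_small_class (M : R) : 0 < M ->
  (\sum_(u : gT) #|'C[u]%g|)%:R <=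
  #|small_class gT M|%:R * #|gT|%:R + #|gT|%:R * (#|gT|%:R / M).
Proof.
move=> M0; rewrite natr_sum (bigID (mem (small_class gT M))) /=; apply: lerD.
  rewrite mulr_natl -sumr_const; apply: ler_sum => u _.
  by rewrite ler_nat max_card.
apply: (@le_trans _ _ (\sum_(u : gT) #|gT|%:R / M)); last first.
  by rewrite sumr_const [leRHS]mulr_natl.
rewrite big_mkcond; apply: ler_sum => u _; case: ifP => [uM|_].
  exact: centralizer_le.
by rewrite divr_ge0 // ltW.
Qed.

(* If [y] and [y u] both square to [c], then [y] inverts [u] by conjugation, and
   the elements inverting [u] lie in a coset of its centralizer. *)
Lemma sqr_card_roots (c : gT) :
  (#|[set y : gT | (y * y)%g == c]| ^ 2 <= \sum_(u : gT) #|'C[u]%g|)%N.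
Proof.
set Y := [set y | _]; rewrite -mulnn -cardsX -sum1_card.
rewrite (partition_big (fun q : gT * gT => (q.1^-1 * q.2)%g) xpredT) //=.
apply: leq_sum => u _; rewrite sum1_card.
apply: leq_trans (card_conj_le u u^-1%g).
rewrite -(card_in_image (f := fst)); last first.
  move=> [y z] [y' z']; rewrite !unfold_in /= => /andP[_ /eqP h] /andP[_ /eqP h'] e.
  congr (_, _) => //; apply: (mulgI y^-1%g); rewrite h -h' e //.
apply: subset_leq_card; apply/subsetP => _ /imageP[[y z] h ->].
rewrite unfold_in /= in h; case/andP: h => /setXP[]; rewrite !inE => /eqP yc /eqP zc /eqP ezu.
have ez : z = (y * u)%g by rewrite -ezu mulKVg.
move: zc; rewrite ez -yc -!mulgA => /mulgI uyu.
by apply/eqP; apply: (mulIg u); rewrite mulVg /= -!mulgA uyu mulVg.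
Qed.
End Centralizers.

(** * The probability that a given element is missed *)

Section MissProbability.
Variables (R : realType) (gT : finGroupType) (d D : nat).
Hypothesis roots_le : forall c : gT, (#|[set y : gT | (y * y)%g == c]| <= D)%N.
Hypothesis centralizers_le : (\sum_(v : gT) #|'C[v]%g| <= D * #|gT|)%N.
Hypothesis d_ge2 : (2 <= d)%N.
Variables (p beta rho : R).
Hypothesis p01 : 0 <= p <= 1.
Hypothesis Np_ge1 : 1 <= #|gT|%:R * p.
Hypothesis beta_ge : (2 * (2 * d%:R) ^+ d) * D%:R <= beta * #|gT|%:R.
Hypothesis rho_ge : (4 * d%:R) ^+ d * (#|gT|%:R * p) ^+ d.-1 / #|gT|%:R <= rho.
Hypothesis rho_le1 : rho <= 1.

(** Janson's inequality for the supports of [x]. Here [beta] bounds the proportion of non-admissible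
    factorizations, [rho] the overlap term, and the denominator is the largest number of admissible
    signed factorizations sharing a support. *)
Lemma miss_probability (strict : bool) (x : gT) : x != 1%g ->
  (strict -> #|'C[x]%g| <= D)%N ->
  expect (fun=> p) (avoids R (enum (supports d strict x))) <=
  expR (- ((2 ^+ d * #|gT|%:R ^+ d.-1 * p ^+ d) * ((1 - beta) * (1 - rho)) /
    ((if (x * x)%g == 1%g then 2 else 1) * (if strict then 1 else d%:R)))).
Proof.
move=> x1 CD; have [p0 p1] := andP p01.
have d0 : (0 < d)%N by lia.
have N0 : 0 < #|gT|%:R :> R by rewrite ltr0n finGroup_card_gt0.
apply: le_trans (@janson R gT p rho d (enum (supports d strict x)) p01 (enum_uniq _) rho_le1 _ _) _.
- move=> A; rewrite mem_enum => /imsetP[w]; case: w => a e /setXP[+ _] ->.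
  by rewrite inE => /and3P[_ ad _]; exact: card_support.
- move=> A; rewrite mem_enum => AF; rewrite big_enum_cond.
  apply: le_trans (sum_overlaps _ _ p01 Np_ge1 _ d0) rho_ge.
  move: AF => /imsetP[w]; case: w => a e /setXP[+ _] ->.
  by rewrite inE => /and3P[_ ad _]; exact: card_support.
rewrite ler_expR lerN2 -cardE.
set m := (X in _ / X).
have m0 : 0 < m by rewrite /m; do 2 case: ifP => _; rewrite ?mulr1 ?mul1r ?mulr_gt0 ?ltr0n.
rewrite ler_pdivrMr // [leRHS](_ : _ = (m * #|supports d strict x|%:R) * p ^+ d * (1 - rho)); last by ring.
have rho1 : 0 <= 1 - rho by rewrite subr_ge0.
suff h : 2 ^+ d * #|gT|%:R ^+ d.-1 * (1 - beta) <= m * #|supports d strict x|%:R.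
  rewrite [leLHS](_ : _ = 2 ^+ d * #|gT|%:R ^+ d.-1 * (1 - beta) * p ^+ d * (1 - rho)); last by ring.
  by rewrite !ler_wpM2r ?exprn_ge0.
have h1 : #|admissible d strict x|%:R * 2 ^+ d <= m * #|supports d strict x|%:R.
  have := card_supports strict x d0; rewrite -(ler_nat R) !natrM natrX => /le_trans; apply.
  by rewrite le_eqVlt; apply/orP; left; apply/eqP; rewrite /m; do 2 case: ifP.
apply: le_trans h1; rewrite -mulrA mulrC ler_wpM2r ?exprn_ge0 //.
have := card_admissible roots_le centralizers_le d_ge2 x1 CD.
have EN := card_factorizations (Ordinal d0) x.
have ER : #|factorizations d x|%:R = #|gT|%:R ^+ d.-1 :> R.
  apply: (mulfI (lt0r_neq0 N0)); rewrite -natrM EN natrX -exprS prednK //.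
rewrite -(ler_nat R) natrD !natrM natrD natrX !natrM ER.
set E := #|gT|%:R ^+ d.-1; set A := #|admissible _ _ _|%:R => h.
have E0 : 0 <= E by rewrite exprn_ge0.
have q : (2 * d%:R) ^+ 2 <= (2 * d%:R) ^+ d :> R.
  by apply: ler_weXn2l => //; rewrite -natrM ler1n; lia.
(* Since [d >= 2], [2 d^2 <= (2 d)^2 <= (2 d)^d], whence the factor 2 in [beta_ge]. *)
have : ((d%:R * 2) ^+ d + d%:R * d%:R * 2) * (D%:R * E) <= beta * #|gT|%:R * E.
  rewrite mulrA ler_wpM2r //; apply: le_trans beta_ge; rewrite ler_wpM2r //.
  move: q; rewrite [d%:R * 2]mulrC; set u := _ ^+ d; rewrite expr2; nra.
move=> h2; rewrite -(ler_pM2l N0); nra.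
Qed.
End MissProbability.

(** * Estimates for large group order *)

Section Asymptotics.
Variables (R : realType).
Implicit Types (lam L eps eta : R).

Lemma expR_ge_sqr (y : R) : 0 <= y -> y ^+ 2 / 4 <= expR y.
Proof.
move=> y0; rewrite [y in leRHS](_ : _ = (y / 2) * 2%:R); last by field.
rewrite expRM_natr; have := expR_ge1Dx (y / 2); set u := expR _ => h.
rewrite !expr2; nra.
Qed.

(** Here [lam] stands for [log log N], so [expR lam] is [log N], and the class bound [M] is
    [expR (2 * L)]. *)
Lemma scale_bounds lam (L := Num.sqrt (expR lam * lam)) : 64 <= lam ->
  [/\ L ^+ 2 = expR lam * lam, 4 * lam <= L & 4 * L <= expR lam].
Proof.
move=> lam64; have l0 : 0 <= lam by lra.
have := expR_ge_sqr l0; have e0 := expR_gt0 lam; set ell := expR lam in L e0 *.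
rewrite expr2 => h; have e16 : 16 * lam <= ell by nra.
have L0 : 0 <= L by exact: sqrtr_ge0.
have L2 : L ^+ 2 = ell * lam by rewrite sqr_sqrtr // mulr_ge0 // ltW.
split=> //; rewrite -ler_sqr ?nnegrE ?mulr_ge0 // ?(ltW e0) //; rewrite exprMn.
  by rewrite L2 !expr2; nra.
by rewrite L2 !expr2; nra.
Qed.

(** The hypothesis says that [d] is at most the square root of [log N / (2 log log N)]. It yields
    [2 d <= expR (lam / 2)] and [d lam <= L], hence the bound on [(2 d)^d]. *)
Lemma degree_bounds lam (d : nat) (L := Num.sqrt (expR lam * lam)) : 64 <= lam ->
  d%:R ^+ 2 * (2 * lam) <= expR lam ->
  d%:R * L <= expR lam /\ (2 * d%:R) ^+ d <= expR (L / 2).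
Proof.
move=> lam64 hd; have [L2 L4 _] := scale_bounds lam64; rewrite -/L in L2 L4.
have l0 : 0 <= lam by lra.
have e0 := expR_gt0 lam; have d0 : 0 <= d%:R :> R by exact: ler0n.
have L0 : 0 <= L by exact: sqrtr_ge0.
split.
  rewrite -ler_sqr ?nnegrE ?mulr_ge0 // ?(ltW e0) // exprMn L2.
  by move: hd; set ell := expR lam in e0 *; set q := _ ^+ 2; rewrite expr2; nra.
have le1 : 2 * d%:R <= expR (lam / 2).
  rewrite -ler_sqr ?nnegrE ?mulr_ge0 ?expR_ge0 // exprMn -expRM_natr.
  rewrite (_ : lam / 2 * 2%:R = lam); last by field.
  move: hd; set q := _ ^+ 2; have : 0 <= q by rewrite exprn_ge0.
  rewrite expr2; nra.
apply: le_trans (_ : expR (lam / 2) ^+ d <= _).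
  by rewrite lerXn2r ?nnegrE ?mulr_ge0 ?expR_ge0.
rewrite -expRM_natr ler_expR mulrAC ler_pM2r ?invr_gt0 //.
rewrite -ler_sqr ?nnegrE ?mulr_ge0 // exprMn L2.
by move: hd; set ell := expR lam in e0 *; set q := d%:R ^+ 2; rewrite expr2; nra.
Qed.

Lemma expRN_small (c y : R) : 0 < c -> c <= y -> expR (- y) <= c^-1.
Proof.
move=> c0 cy; rewrite expRN lef_pV2 ?posrE ?expR_gt0 //.
apply: le_trans cy _; apply: le_trans (expR_ge1Dx y); lra.
Qed.

Lemma p_thr_exprn (eps : R) (d N : nat) : 0 < eps -> (0 < d)%N -> (1 < N)%N ->
  p_thr eps d N ^+ d = (1 + eps) / 2 ^+ d * (ln N%:R / N%:R ^+ d.-1).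
Proof.
move=> eps0 d0 N1; have N0 : 0 < N%:R :> R by rewrite ltr0n; lia.
set y := (RHS); have y0 : 0 <= y.
  rewrite /y !mulr_ge0 ?invr_ge0 ?exprn_ge0 ?ln_ge0 ?ler1n //; first by lra.
  by lia.
rewrite /p_thr -/y -powR_mulrn ?powR_ge0 // -powRrM mulVf ?powRr1 //.
by rewrite pnatr_eq0; lia.
Qed.
End Asymptotics.

(** Instantiates [miss_probability] with errors that are exponentially small in [L], then sums over
    [x] according to the four possible multiplicities. *)
Lemma prob_diam_gt_threshold (R : realType) (eps lam : R) (gT : finGroupType) (d : nat)
    (N : R := #|gT|%:R) (ell := expR lam) (L := Num.sqrt (ell * lam))
    (p := p_thr eps d #|gT|) :
  0 < eps < 1 -> 64 <= lam -> 256 / eps <= lam -> N = expR ell ->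
  (2 <= d)%N -> d%:R ^+ 2 * (2 * lam) <= ell ->
  #|involutions gT|%:R <= N `^ ((2 + eps) / 4) ->
  #|small_class gT (expR (2 * L))|%:R <= N `^ (d%:R)^-1 ->
  #|involutions gT :&: small_class gT (expR (2 * L))|%:R <= N `^ (2 * d%:R)^-1 ->
  p <= 1 -> prob_diam_gt gT p d <= 4 * expR (- (eps * L / 8)).
Proof.
move=> eps01 lam_ge64 lam_ge_eps N_def d_ge2 d_le inv_le small_le small_inv_le p_le1.
pose S := small_class gT (expR (2 * L)).
(* The centralizer orders sum to at most [2 expR (- 2 L) N^2], and the square root of this bounds
   the number of roots by [2 expR (- L) N]. Rounding up costs at most [expR (- L) N], which is at
   least 1. *)
pose D := (Num.truncn (2 * expR (- L) * N)).+1.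
(* [t] bounds both the proportion of non-admissible factorizations and the
   overlap term in Janson's inequality. *)
pose t := 4 * expR (- (L / 4)).
have lam_L : 4 * lam <= L by have [] := scale_bounds lam_ge64.
have L_ell : 4 * L <= ell by have [] := scale_bounds lam_ge64.
have dL : d%:R * L <= ell by have [] := degree_bounds lam_ge64 d_le.
have dd : (2 * d%:R) ^+ d <= expR (L / 2) by have [] := degree_bounds lam_ge64 d_le.
have L_ge : 256 <= L by move: lam_L lam_ge64; generalize L lam; clear => *; lra.
have L_le_ell : L <= ell by move: L_ge L_ell; generalize L ell; clear => *; lra.
have ell_gt0 : 0 < ell by exact: expR_gt0.
have N_gt0 : 0 < N by rewrite N_def expR_gt0.
have d_pos : (0 < d)%N by exact: ltnW.
have d_gt0 : 0 < d%:R :> R by rewrite ltr0n.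
have N_powR (y : R) : N `^ y = expR (ell * y) by rewrite N_def -expRM.
have card_gt1 : (1 < #|gT|)%N by rewrite -(ltr_nat R) -/N N_def -[1%:R]expR0 ltr_expR.
have D_ge : 2 * expR (- L) * N <= D%:R by apply: ltW; exact: truncnS_gt.
have D_le : D%:R <= 3 * expR (- L) * N.
  have e0 : 0 <= 2 * expR (- L) * N by rewrite !mulr_ge0 ?expR_ge0 // ltW.
  rewrite /D -natr1 (_ : 3 * _ * _ = 2 * expR (- L) * N + expR (- L) * N); last first.
    by generalize (expR (- L)) N; clear => *; ring.
  apply: lerD; first by rewrite truncn_le.
  by rewrite N_def -expRD -[leLHS]expR0 ler_expR addrC subr_ge0.
(* By (b) and [d >= 2], at most [N^(1/2)] elements have small classes, and
   [N^(1/2) <= expR (- 2 L) N] because [4 L <= ell]. *)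
have sum_centralizers_N : (\sum_(u : gT) #|'C[u]%g|)%:R <= 2 * expR (- (2 * L)) * N * N.
  apply: le_trans (sum_centralizers_small_class gT (expR_gt0 (2 * L))) _.
  rewrite -expRN -/S -/N.
  have arith (s e n : R) : 0 < n -> s <= e * n -> s * n + n * (n * e) <= 2 * e * n * n.
    by clear => *; nra.
  apply: arith => //.
  apply: le_trans small_le _; rewrite N_powR N_def -expRD ler_expR.
  have d2 : 2 <= d%:R :> R by rewrite ler_nat.
  have : d%:R^-1 <= 2^-1 :> R by rewrite lef_pV2 ?posrE.
  by move: ell_gt0 L_ell; generalize (d%:R^-1 : R) ell L; clear => *; nra.
have expR2L : expR (- (2 * L)) = expR (- L) * expR (- L).
  by rewrite -expRD; congr expR; rewrite mulr_natl mulr2n opprD.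
have expRL_le1 : expR (- L) <= 1 by rewrite -[leRHS]expR0 ler_expR oppr_le0 (le_trans _ L_ge).
have roots_le (c : gT) : (#|[set y : gT | (y * y)%g == c]| <= D)%N.
  rewrite -(ler_nat R); apply: le_trans D_ge.
  rewrite -ler_sqr ?nnegrE ?mulr_ge0 ?expR_ge0 ?ler0n ?(ltW N_gt0) //.
  rewrite -natrX; apply: (@le_trans _ _ (\sum_(u : gT) #|'C[u]%g|)%:R).
    by rewrite ler_nat; exact: sqr_card_roots.
  apply: le_trans sum_centralizers_N _; rewrite expR2L expr2.
  have : 0 <= expR (- L) * expR (- L) * (N * N) by rewrite !mulr_ge0 ?expR_ge0 ?(ltW N_gt0).
  by generalize (expR (- L)) N; clear => *; nra.
have centralizers_le : (\sum_(v : gT) #|'C[v]%g| <= D * #|gT|)%N.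
  rewrite -(ler_nat R) natrM -/N; apply: le_trans sum_centralizers_N _.
  rewrite ler_wpM2r ?(ltW N_gt0) //; apply: le_trans D_ge.
  rewrite expR2L ler_wpM2r ?(ltW N_gt0) // ler_wpM2l // ler_piMr ?expR_ge0 //.
have strict_le (x : gT) : x \notin S -> (#|'C[x]%g| <= D)%N.
  move=> xS; rewrite -(ler_nat R); apply: le_trans (centralizer_le (expR_gt0 _) xS) _.
  apply: le_trans D_ge; rewrite -expRN -/N expR2L [leLHS]mulrC.
  rewrite ler_wpM2r ?(ltW N_gt0) //; move: expRL_le1 (expR_gt0 (- L)).
  by generalize (expR (- L)); clear => *; nra.
have lnN : ln N = ell by rewrite N_def expRK.
have p_ge0 : 0 <= p by exact: powR_ge0.
have p_pow : 2 ^+ d * N ^+ d.-1 * p ^+ d = (1 + eps) * ell.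
  have /andP[e0 _] := eps01.
  rewrite p_thr_exprn //.
  rewrite -/N lnN.
  have arith (u v k l : R) : u != 0 -> v != 0 -> u * v * (k / u * (l / v)) = k * l.
    by clear => u0 v0; field; rewrite u0 v0.
  by apply: arith; rewrite expf_neq0 ?lt0r_neq0.
have Np_pow : (2 * (N * p)) ^+ d = (1 + eps) * ell * N.
  rewrite -p_pow !exprMn.
  have -> : N ^+ d = N * N ^+ d.-1 by rewrite -exprS prednK.
  have arith (u v w n : R) : u * (n * v * w) = u * v * w * n by clear; ring.
  exact: arith.
(* Compares [d]-th powers: [expR (d L) <= N <= (1 + eps) ell N]. *)
have Np_ge : expR L <= 2 * (N * p).
  have /andP[e0 _] := eps01.
  rewrite -(@ler_pXn2r _ d) ?nnegrE ?expR_ge0 ?mulr_ge0 ?(ltW N_gt0) //.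
  rewrite Np_pow -expRM_natr.
  apply: le_trans (_ : N <= _); first by rewrite N_def ler_expR mulrC.
  have ell1 : 1 <= ell by apply: le_trans L_le_ell; apply: le_trans L_ge; rewrite ler1n.
  by rewrite ler_peMl ?(ltW N_gt0) // mulr_ege1 // lerDl ltW.
have Np_ge1 : 1 <= N * p.
  have arith (z u l : R) : u <= 2 * z -> 1 + l <= u -> 256 <= l -> 1 <= z by clear => *; lra.
  exact: arith Np_ge (expR_ge1Dx L) L_ge.
(* By [Np_pow] the left side equals [(2 d)^d (1 + eps) ell / (N p)]; the factors are at most
   [expR (L / 2)], [2 expR (L / 4)] and [2 expR (- L)]. *)
have rho_le : (4 * d%:R) ^+ d * (N * p) ^+ d.-1 / N <= t.
  have /andP[e0 e1] := eps01.
  have Np0 : 0 < N * p by apply: lt_le_trans Np_ge1.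
  have E : (4 * d%:R) ^+ d * (N * p) ^+ d.-1 / N = (2 * d%:R) ^+ d * ((1 + eps) * ell) / (N * p).
    apply: (mulIf (lt0r_neq0 Np0)); rewrite divfK ?lt0r_neq0 //.
    apply: (mulIf (lt0r_neq0 N_gt0)).
    have e4 : (4 * d%:R) ^+ d = 2 ^+ d * (2 * d%:R) ^+ d :> R.
      by rewrite -exprMn; congr (_ ^+ _); clear; ring.
    have eNp : (N * p) ^+ d = (N * p) ^+ d.-1 * (N * p) by rewrite -exprSr prednK.
    have arith (u v w z n k : R) : n != 0 -> u * (w * z) = k * n ->
        u * v * w / n * z * n = v * k * n.
      by clear => n0 h; rewrite -[RHS]mulrA -h; field.
    rewrite e4; move: Np_pow; rewrite exprMn eNp.
    exact: arith (lt0r_neq0 N_gt0).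
  rewrite E ler_pdivrMr //.
  have ellL : ell <= expR (L / 4) by rewrite ler_expR ler_pdivlMr // mulrC.
  have h1 : (2 * d%:R) ^+ d * ((1 + eps) * ell) <= expR (L / 2) * (2 * expR (L / 4)).
    apply: ler_pM => //; first by rewrite exprn_ge0 // mulr_ge0.
      by rewrite mulr_ge0 ?(ltW ell_gt0) // addr_ge0 // ltW.
    by apply: ler_pM => //; rewrite ?(ltW ell_gt0) ?addr_ge0 ?(ltW e0) // lerD2l ltW.
  apply: le_trans h1 _.
  apply: le_trans (_ : t * (expR L / 2) <= _); last first.
    by rewrite ler_wpM2l ?mulr_ge0 ?expR_ge0 // ler_pdivrMr // mulrC.
  have arith (u v w z : R) : u * v <= w * z -> u * (2 * v) <= 4 * w * (z / 2).
    by clear => *; lra.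
  apply: arith; rewrite -!expRD ler_expR.
  have arith' (l : R) : 256 <= l -> l / 2 + l / 4 <= - (l / 4) + l by clear => *; lra.
  exact: arith'.
(* Small enough that [(1 + eps) (1 - t)^2 >= 1 + 3 eps / 4]. *)
have t_le : t <= eps / 16.
  have /andP[e0 e1] := eps01.
  have h : 0 < 64 / eps by rewrite divr_gt0.
  have : expR (- (L / 4)) <= (64 / eps)^-1.
    apply: expRN_small => //; rewrite ler_pdivlMr //.
    rewrite (_ : 64 / eps * 4 = 256 / eps); last by rewrite mulrAC -natrM.
    apply: le_trans lam_ge_eps _; apply: le_trans lam_L.
    by rewrite ler_peMl ?ler1n // (le_trans _ lam_ge64).
  have arith (u : R) : u <= eps / 64 -> 4 * u <= eps / 16 by clear => *; lra.
  by rewrite invf_div; exact: arith.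
have beta_ge : (2 * (2 * d%:R) ^+ d) * D%:R <= t * N.
  apply: le_trans (_ : (2 * expR (L / 2)) * (3 * expR (- L) * N) <= _).
    apply: ler_pM => //; first by rewrite mulr_ge0 // exprn_ge0 // mulr_ge0.
    by rewrite ler_wpM2l.
  have e2 : expR (L / 2) * expR (- L) = expR (- (L / 4)) * expR (- (L / 4)).
    by rewrite -!expRD; congr expR; clear; field.
  have e3 : expR (- (L / 4)) <= 2^-1.
    by apply: expRN_small => //; rewrite ler_pdivlMr // -natrM (le_trans _ L_ge) // ler_nat.
  have arith (u v w n : R) : 0 < n -> 0 < w -> u * v = w * w -> w <= 2^-1 ->
      2 * u * (3 * v * n) <= 4 * w * n.
    clear => n0 w0 uv w2; rewrite (_ : 2 * u * (3 * v * n) = 6 * (u * v) * n); last by ring.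
    by rewrite ler_wpM2r ?(ltW n0) // uv; nra.
  exact: arith N_gt0 (expR_gt0 _) e2 e3.
have miss (x : gT) : x != 1%g ->
  expect (fun=> p) (avoids R (enum (supports d (x \notin S) x))) <=
  expR (- ((1 + 3 / 4 * eps) * ell /
    ((if x \in involutions gT then 2 else 1) * (if x \notin S then 1 else d%:R)))).
  move=> x1; have /andP[e0 e1] := eps01.
  have t0 : 0 <= t by rewrite mulr_ge0 ?expR_ge0.
  have p01 : 0 <= p <= 1 by rewrite p_ge0 p_le1.
  have t1 : t <= 1 by apply: le_trans t_le _; rewrite ler_pdivrMr // mul1r (le_trans (ltW e1)) // ler1n.
  apply: le_trans (miss_probability roots_le centralizers_le d_ge2 p01 Np_ge1 beta_ge rho_le t1 x1
    (@strict_le x)) _.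
  have -> : (x \in involutions gT) = ((x * x)%g == 1%g) by rewrite inE expgS expg1.
  rewrite -/N p_pow ler_expR lerN2.
  apply: ler_wpM2r; first by rewrite invr_ge0 mulr_ge0 //; do 2?[case: ifP].
  rewrite [leRHS]mulrAC ler_wpM2r ?(ltW ell_gt0) //.
  have arith (e u : R) : 0 < e -> e < 1 -> 0 <= u -> u <= e / 16 ->
      1 + 3 / 4 * e <= (1 + e) * ((1 - u) * (1 - u)) by clear => *; nra.
  exact: arith.
have /andP[e0 e1] := eps01.
have p01 : 0 <= p <= 1 by rewrite p_ge0 p_le1.
apply: le_trans (prob_diam_gt_le d (fun x => x \notin S) p01) _.
(* The involution term is the tightest: [N^((2 + eps) / 4)] times [g 2] is [N^(- eps / 8)], the
   origin of the exponent [eps * L / 8]. *)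
pose g (m : R) := expR (- ((1 + 3 / 4 * eps) * ell / m)).
have g0 m : 0 <= g m by exact: expR_ge0.
have gle (C : R) m y : C <= expR y -> y - (1 + 3 / 4 * eps) * ell / m <= - (eps * L / 8) ->
    C * g m <= expR (- (eps * L / 8)).
  move=> Cy ym; apply: le_trans (_ : expR y * g m <= _); first by rewrite ler_wpM2r.
  by rewrite /g -expRD ler_expR.
(* Each [x] is charged to the term of its own multiplicity 1, 2, [d] or [2 d]; the surplus terms are
   nonnegative. *)
apply: (@le_trans _ _ (N * g 1 + #|involutions gT|%:R * g 2 + #|S|%:R * g d%:R +
    #|involutions gT :&: S|%:R * g (2 * d%:R))).
  have sumA (A : {set gT}) (c : R) : \sum_x (x \in A)%:R * c = #|A|%:R * c.
    rewrite -mulr_suml -natr_sum sum_nat_pred1; congr (_%:R * _).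
    by apply: eq_card => x; rewrite inE.
  have -> : N * g 1 = \sum_(x : gT) g 1 by rewrite sumr_const mulr_natl.
  rewrite -!sumA -!big_split /= [leLHS]big_mkcond; apply: ler_sum => x _.
  have nn : 0 <= g 1 + (x \in involutions gT)%:R * g 2 + (x \in S)%:R * g d%:R +
      (x \in involutions gT :&: S)%:R * g (2 * d%:R) by rewrite !addr_ge0 ?mulr_ge0.
  case: ifP => // x1. apply: le_trans (miss x x1) _.
  have [[[g1 g2] gd] g2d] := (g0 1, g0 2, g0 d%:R, g0 (2 * d%:R)).
  rewrite [x \in _ :&: _]in_setI -/(g _).
  have arith (u v w z : R) : 0 <= u -> 0 <= v -> 0 <= w -> 0 <= z ->
      [/\ u <= u + 0 + 0 + 0, v <= u + v + 0 + 0, w <= u + 0 + w + 0 & z <= u + v + w + z].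
    by clear => *; split; lra.
  have [a1 a2 a3 a4] := arith _ _ _ _ g1 g2 gd g2d.
  by case: (x \in involutions gT); case: (x \in S); rewrite /= ?mulr1 ?mul1r ?mul0r.
have Ld : L <= ell / d%:R by rewrite ler_pdivlMr // mulrC.
(* Used with [k = ell] for multiplicities 1 and 2, and with [k = ell / d] for [d] and [2 d]; both
   are at least [L]. *)
have arith (e l k : R) : 0 < e -> 0 < l -> l <= k ->
    [/\ k - (1 + 3 / 4 * e) * k <= - (e * l / 8),
        k * ((2 + e) / 4) - (1 + 3 / 4 * e) * k / 2 <= - (e * l / 8) &
        k / 2 - (1 + 3 / 4 * e) * k / 2 <= - (e * l / 8)].
  by clear => *; split; nra.
have L0 : 0 < L by apply: lt_le_trans L_ge; rewrite ltr0n.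
have [a1 a2 _] := arith _ _ _ e0 L0 L_le_ell; have [a3 _ a4] := arith _ _ _ e0 L0 Ld.
have b1 : N * g 1 <= expR (- (eps * L / 8)).
  by apply: (gle _ _ ell); rewrite ?N_def ?divr1.
have b2 : #|involutions gT|%:R * g 2 <= expR (- (eps * L / 8)).
  by apply: (gle _ _ (ell * ((2 + eps) / 4))); rewrite -?N_powR.
have b3 : #|S|%:R * g d%:R <= expR (- (eps * L / 8)).
  by apply: (gle _ _ (ell / d%:R)); rewrite -?N_powR // -mulrA.
have b4 : #|involutions gT :&: S|%:R * g (2 * d%:R) <= expR (- (eps * L / 8)).
  have dV (u : R) : u / (2 * d%:R) = u / d%:R / 2 by rewrite invfM [2^-1 * _]mulrC mulrA.
  apply: (gle _ _ (ell / (2 * d%:R))); first by rewrite -N_powR.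
  by rewrite !dV -[X in _ - X / 2]mulrA.
have arith4 (u v w z k : R) : u <= k -> v <= k -> w <= k -> z <= k -> u + v + w + z <= 4 * k.
  by clear => *; lra.
exact: arith4.
Qed.

Theorem theorem6 (R : realType) (gamma : R) :
  0 < gamma < 1 ->
  exists eps0 : R, 0 < eps0 /\
  forall eps : R, 0 < eps < eps0 ->
  forall eta : R, 0 < eta ->
  exists N0 : nat, forall N : nat, (N0 <= N)%N ->
  forall gT : finGroupType, #|gT| = N ->
  forall d : nat, (2 <= d)%N -> d%:R <= dN gamma N ->
  (#|involutions gT|%:R <= N%:R `^ ((2 + eps) / 4)) ->
  (#|small_class gT (MN R N)|%:R <= (N%:R : R) `^ (d%:R)^-1) ->
  (#|involutions gT :&: small_class gT (MN R N)|%:R <= (N%:R : R) `^ (2 * d%:R)^-1) ->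
  forall p : R, p_thr eps d N <= p <= 1 ->
  prob_diam_gt gT p d <= eta.
Proof.
move=> /andP[gam0 gam1]; exists 1; split=> // eps eps01 eta eta0.
have /andP[e0 e1] := eps01.
(* The first two summands serve the hypotheses on [lam] in [prob_diam_gt_threshold]. The third makes
   [4 * expR (- (eps * L / 8)) <= eta], through [L >= 4 lam] and [expRN_small]. *)
pose Lam := 64 + 256 / eps + 32 / (eps * eta).
have h1 : 0 < 256 / eps by rewrite divr_gt0.
have h2 : 0 < 32 / (eps * eta) by rewrite divr_gt0 ?mulr_gt0.
(* A double exponential, so that [log log N > Lam]; it depends only on [eps] and [eta], which gives
   the uniformity. *)
exists (Num.truncn (expR (expR Lam))).+1 => N + gT eN d d2; case: N / eN.
rewrite -(ler_nat R) => /(lt_le_trans (truncnS_gt _)) N_gt.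
have N0 : 0 < #|gT|%:R :> R by exact: lt_trans (expR_gt0 _) N_gt.
pose ell := ln (#|gT|%:R : R); pose lam := ln ell.
have ell_gt : expR Lam < ell by rewrite -ltr_expR lnK ?posrE.
have ell0 : 0 < ell by exact: lt_trans (expR_gt0 _) ell_gt.
have lamE : expR lam = ell by rewrite lnK ?posrE.
have lam_gt : Lam < lam by rewrite -ltr_expR lamE.
have NE : #|gT|%:R = expR (expR lam) by rewrite lamE lnK ?posrE.
have lam0 : 0 < lam by rewrite /Lam in lam_gt; lra.
rewrite /dN /MN -/ell -/lam => d_dN inv_le small_le small_inv_le p /andP[p_ge p1].
have d_le : d%:R ^+ 2 * (2 * lam) <= expR lam.
  rewrite lamE -ler_pdivlMr ?mulr_gt0 //.
  have q0 : 0 <= ell / (2 * lam) by rewrite divr_ge0 ?mulr_ge0 // ltW.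
  rewrite -(sqr_sqrtr q0) lerXn2r ?nnegrE ?sqrtr_ge0 //.
  apply: le_trans d_dN _; rewrite ler_piMl ?sqrtr_ge0 //; lra.
(* Adding generators cannot increase the diameter, so [p] may be lowered to the threshold. *)
apply: le_trans (@prob_diam_gt_antitone gT R (p_thr eps d #|gT|) p d _ p1) _.
  by rewrite p_ge powR_ge0.
have lam64 : 64 <= lam by rewrite /Lam in lam_gt; lra.
have lam_eps : 256 / eps <= lam by rewrite /Lam in lam_gt; lra.
rewrite -lamE in small_le small_inv_le.
apply: le_trans (prob_diam_gt_threshold eps01 lam64 lam_eps NE d2 d_le inv_le small_le
  small_inv_le (le_trans p_ge p1)) _.
have [_ lamL _] := scale_bounds lam64; move: lamL; set L := Num.sqrt _ => lamL.
have h3 : 0 < 4 / eta by rewrite divr_gt0.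
have : expR (- (eps * L / 8)) <= (4 / eta)^-1.
  apply: expRN_small => //.
  have -> : 4 / eta = (32 / (eps * eta)) * eps / 8.
    by field; rewrite !lt0r_neq0.
  rewrite ler_pM2r ?invr_gt0 // mulrC ler_pM2l //.
  by rewrite /Lam in lam_gt; lra.
by rewrite invf_div; lra.
Qed.
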